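(* Let $X$ be a complex Banach space with a $1$-unconditional Schauder basis $(e_j)_{j\ge1}$. Then the associated monomials $e^{*\alpha}$, $\alpha\in\mathbb N_0^{(\mathbb N)}$, with the square order in each homogeneous degree and with any compatible global ordering, form a Schauder basis of $(\mathcal H(X),\tau_0)$.
   Context: A Schauder basis $(e_j)$ of $X$ is $1$-unconditional if $\|\sum_j\lambda_jx_je_j\|\le\|\sum_jx_je_j\|$ whenever $\sum_j x_je_j\in X$ and $|\lambda_j|\le1$ for all $j$. $\mathcal H(X)$ is the space of entire holomorphic functions $X\to\mathbb C$, and $\tau_0$ is the compact-open topology, generated by the seminorms $\|f\|_K=\sup_{x\in K}|f(x)|$, $K\subset X$ compact. A Schauder basis of a locally convex space is understood in the usual sense (unique convergent expansions with continuous coefficient functionals). Let $(e_j^* )$ be the coefficient functionals of $(e_j)$. $\mathbb N_0^{(\mathbb N)}$ is the set of finitely supported multi-indices $\alpha=(\alpha_j)_{j\ge1}$, $\alpha_j\in\mathbb N_0$; $|\alpha|=\sum_j\alpha_j$ (the degree); $\operatorname{len}(\alpha)=\max\operatorname{supp}(\alpha)$, with $\operatorname{len}(0)=0$; and $e^{*\alpha}(x)=\prod_j e_j^*(x)^{\alpha_j}$. Square order: for multi-indices $\alpha,\beta$ of the same degree, $\alpha\prec\beta$ if either (i) $\operatorname{len}(\alpha)<\operatorname{len}(\beta)$, or (ii) $\operatorname{len}(\alpha)=\operatorname{len}(\beta)$ and, for $j=\max\{i:\alpha_i\ne\beta_i\}$, one has $\alpha_j<\beta_j$. An ordering (enumeration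 as a sequence) of all monomials is called compatible if, for every $n\in\mathbb N_0$, its restriction to the degree-$n$ monomials agrees with the square order. *)

(* Defs.v *)
From HB Require Import structures.
From mathcomp Require Import all_boot all_order all_algebra.
From mathcomp Require Import finmap complex.
From mathcomp Require Import all_classical all_reals all_analysis.

Set Implicit Arguments.
Unset Strict Implicit.
Unset Printing Implicit Defensive.

Import Order.TTheory GRing.Theory Num.Def Num.Theory.
Import numFieldNormedType.Exports.

Local Open Scope classical_set_scope.
Local Open Scope ring_scope.

Section SchauderBasis.
Context (K : numFieldType) (E : tvsType K).
Implicit Types (b : nat -> E) (a : nat -> K) (x : E).

Definition expansion b a x := series (fun j => a j *: b j) @ \oo --> x.

(* Only meaningful when the expansion of x along b exists and is unique. *)
Definition coef b (j : nat) x : K := xget (fun=> 0) [set a | expansion b a x] j.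

Definition schauder_basis b :=
  (forall x, exists! a, expansion b a x) /\
  (forall j, continuous (coef b j : E -> K^o)).

Lemma schauder_coefP b x : schauder_basis b ->
  expansion b (fun j => coef b j x) x.
Proof.
move=> [/(_ x)[a [ax _]] _].
exact: (@xgetPex _ (fun=> 0) [set a | expansion b a x] (ex_intro _ a ax)).
Qed.

Lemma schauder_coef_uniq b a x : schauder_basis b -> expansion b a x ->
  a = fun j => coef b j x.
Proof.
move=> bb ax; case: (bb) => /(_ x)[c [cx cu]] _.
by rewrite -(cu a ax); apply/cu/schauder_coefP.
Qed.

Lemma coef_is_linear b j : schauder_basis b -> linear (coef b j : E -> K^o).
Proof.
move=> bb k x y.
suff exy : expansion b (fun i => k * coef b i x + coef b i y) (k *: x + y).
  by have /(congr1 (@^~ j))/= <- := schauder_coef_uniq bb exy.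
rewrite /expansion.
have -> : series (fun i => (k * coef b i x + coef b i y) *: b i) =
    (fun n => k *: series (fun i => coef b i x *: b i) n
              + series (fun i => coef b i y *: b i) n).
  apply/funext => n; rewrite /series/= scaler_sumr -big_split/=.
  by apply: eq_bigr => i _; rewrite scalerDl scalerA.
have cx := @schauder_coefP b x bb; have cy := @schauder_coefP b y bb.
apply: (@continuous2_cvg _ E E E _ _ _ _ (fun u v : E => u + v)) cy.
  exact: (@add_continuous E (k *: x, y)).
apply: (@continuous2_cvg _ K^o E E _ _ _ _ (fun u v => u *: v) k x) cx.
  exact: (@scale_continuous K E (k, x)).
exact: cvg_cst.
Qed.

End SchauderBasis.

(* The existence of y expresses that the series of l j * a j *: b j converges. *)
Definition unconditional1 (K : numFieldType) (X : normedModType K)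
    (b : nat -> X) :=
  forall (a l : nat -> K) (x : X), expansion b a x ->
  (forall j, `|l j| <= 1) ->
  exists2 y : X, expansion b (fun j => l j * a j) y & `|y| <= `|x|.

Section EntireFunctions.
Context (K : numFieldType) (X : normedModType K).

(* Frechet differentiability over K; holomorphy when K is the complex field. *)
Definition entire_pred : {pred X -> K^o} :=
  mem [set f : X -> K^o | forall x, differentiable f x].

Record entire := Entire {
  entire_val :> X -> K^o;
  entire_subproof : entire_val \in entire_pred
}.

HB.instance Definition _ := [isSub for entire_val].
HB.instance Definition _ := [Choice of entire by <:].

Lemma entireP (f : entire) x : differentiable f x.
Proof. by have := entire_subproof f; rewrite inE; apply. Qed.

Lemma entire_submod_closed : submod_closed entire_pred.
Proof.
split=> [|k f g]; rewrite !inE/=; first by move=> x; exact: differentiable_cst.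
by move=> df dg x; apply: differentiableD => //; exact: differentiableZ.
Qed.

HB.instance Definition _ :=
  GRing.isSubmodClosed.Build K (X -> K^o) entire_pred entire_submod_closed.
HB.instance Definition _ := [SubChoice_isSubLmodule of entire by <:].

HB.instance Definition _ := Uniform.copy entire
  (initial_topology (entire_val : entire -> {family compact, X -> K^o})).

Lemma nbhs_entireP (f : entire) (U : set entire) : nbhs f U <->
  exists A : set X, exists e : K, [/\ compact A, 0 < e &
    [set g : entire | forall x, A x -> `|f x - g x| < e] `<=` U].
Proof.
split.
- pose B (p : set X * K) := [set g : X -> K^o |
    forall x, p.1 x -> `|f x - g x| < p.2].
  pose D : set (set X * K) := [set p | compact p.1 /\ 0 < p.2].
  pose F := filter_from D B.
  have FF : Filter F.
    apply: filter_from_filter.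
      by exists (set0, 1); split => //=; exact: compact0.
    move=> [A e] [A' e'] [/= cA e0] [/= cA' e'0].
    have [m [m0 [me me']]] : exists m : K, 0 < m /\ m <= e /\ m <= e'.
      have [ee'|/ltW e'e] := real_leP (gtr0_real e0) (gtr0_real e'0).
        by exists e.
      by exists e'.
    exists (A `|` A', m); first by split => //=; exact: compactU.
    move=> g /= gm; split => x /= Ax.
      by apply: lt_le_trans me; apply: gm; left.
    by apply: lt_le_trans me'; apply: gm; right.
  have Ff : {family compact, F --> (f : X -> K^o)}.
    apply/fam_cvgP => A cA P /uniform_nbhs[V [entV VP]].
    move: entV; rewrite -entourage_ballE => -[e /= e0 eV].
    exists (A, e) => // g /= ge; apply: VP => x Ax; apply: eV.
    by rewrite /ball/= ; exact: ge.
  case=> [_ [[W oW <-] Wf WU]].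
  have [| [A e] [/= cA e0] BW] := Ff W; first exact: open_nbhs_nbhs.
  by exists A, e; split=> // g /= ge; apply/WU/BW.
- move=> [A [e [cA e0]]] /filterS; apply.
  have := @initial_continuous _ {family compact, X -> K^o} (@entire_val) f
    [set g : {family compact, X -> K^o} | forall x, A x -> `|f x - g x| < e].
  apply.
  apply: (@fam_nbhs _ K^o _ A [set p | `|p.1 - p.2| < e]) => //.
  by rewrite -entourage_ballE; exists e.
Qed.

Lemma entire_add_continuous :
  continuous (fun p : entire * entire => p.1 + p.2).
Proof.
move=> [f g] U /nbhs_entireP[A [e [cA e0 eU]]].
pose V (h : entire) :=
  [set h' : entire | forall x, A x -> `|h x - h' x| < e / 2].
have V_nbhs h : nbhs h (V h).
  by apply/nbhs_entireP; exists A, (e / 2); split; rewrite ?divr_gt0.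
exists (V f, V g) => [|[f' g'] /= [fV gV]]; first by split; exact: V_nbhs.
apply: eU => x Ax /=; rewrite opprD addrACA [e]splitr.
by rewrite (le_lt_trans (ler_normD _ _))// ltrD ?fV ?gV.
Qed.

Lemma entire_bounded (f : entire) (A : set X) : compact A ->
  exists2 M : K, 0 < M & forall x, A x -> `|f x| <= M.
Proof.
move=> /compact_near_coveringP cA.
suff /pinfty_ex_gt0[M M0 fM] : \forall M \near +oo, A `<=` (fun x => `|f x| <= M).
  by exists M.
apply: (cA K (+oo)) => x Ax.
exists ([set y | `|f x - f y| < 1], [set M : K | `|f x| + 1 < M]).
  split => /=; last first.
    by exists (`|f x| + 1); split => //; rewrite ger0_real// addr_ge0.
  apply: (differentiable_continuous (entireP f x) (t := [set z | `|f x - z| < 1])).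
  by apply/nbhs_ballP; exists 1 => /=; [exact: ltr01|move=> z].
move=> [y M] [/= fxy fxM]; rewrite (le_trans _ (ltW fxM))//.
rewrite -(subrK (f x) (f y)) (le_trans (ler_normD _ _))// addrC lerD2l.
by rewrite distrC ltW.
Qed.

Lemma entire_scale_continuous :
  continuous (fun p : K^o * entire => p.1 *: p.2).
Proof.
move=> [k f] U /nbhs_entireP[A [e [cA e0 eU]]].
have [M M0 fM] := entire_bounded f cA.
pose d := e / 2 / (`|k| + 1).
have k0 : 0 < `|k| + 1 by rewrite ltr_wpDl.
have M10 : 0 < M + 1 by rewrite addr_gt0.
have d0 : 0 < d by rewrite !divr_gt0.
exists ([set k' | `|k - k'| < e / 2 / (M + 1)],
        [set g : entire | forall x, A x -> `|f x - g x| < 1] `&`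
        [set g : entire | forall x, A x -> `|f x - g x| < d]).
  split => /=.
    apply/nbhs_ballP; exists (e / 2 / (M + 1)) => /=.
      by rewrite !divr_gt0.
    by move=> z; rewrite -ball_normE.
  apply: filterI; apply/nbhs_entireP.
    by exists A, 1; split => //; exact: ltr01.
  by exists A, d; split => //.
move=> [k' g] /= [kk' [g1 gd]]; apply: eU => x Ax /=.
have -> : k *: f x - k' *: g x = k * (f x - g x) + (k - k') * g x.
  by rewrite mulrBr mulrBl addrA subrK.
rewrite (le_lt_trans (ler_normD _ _))// [e]splitr !normrM ler_ltD//.
  rewrite (@le_trans _ _ ((`|k| + 1) * d))//.
    by apply: ler_pM => //; [rewrite lerDl|exact/ltW/gd].
  by rewrite /d mulrC divfK// gt_eqF.
have gM : `|g x| <= M + 1.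
  rewrite -(subrK (f x) (g x)) (le_trans (ler_normD _ _))// addrC lerD ?fM//.
  by rewrite distrC ltW// g1.
rewrite (@le_lt_trans _ _ (`|k - k'| * (M + 1))) ?ler_wpM2l//.
by rewrite -ltr_pdivlMr.
Qed.

Lemma entire_locally_convex : exists2 B : set_system entire,
  (forall b, b \in B -> convex_set b) & basis B.
Proof.
pose V (f : entire) (A : set X) (e : K) : set entire :=
  [set g : entire | exists2 r, r < e & forall x, A x -> `|f x - g x| <= r].
exists [set V p.1.1 p.1.2 p.2 |
         p in [set p : entire * set X * K | compact p.1.2 /\ 0 < p.2]].
  move=> b /set_mem[[[f A] e] [/= cA e0] <-]; apply/convex_setW.
  move=> g h /set_mem[r re gr] /set_mem[s se hs] l l0 l1; apply/mem_set.
  have l1' : 0 < 1 - l%:num by rewrite subr_gt0.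
  exists (l%:num * r + (1 - l%:num) * s) => [|x Ax].
    rewrite [ltRHS](_ : _ = l%:num * e + (1 - l%:num) * e).
      by rewrite ltrD// ltr_pM2l.
    by rewrite -mulrDl addrC subrK mul1r.
  have -> : f x - conv l (g : convex_lmodType entire) h x =
      l%:num * (f x - g x) + (1 - l%:num) * (f x - h x).
    rewrite !mulrBr addrACA -mulrDl [l%:num + _]addrC subrK mul1r.
    by rewrite -opprD.
  rewrite (le_trans (ler_normD _ _))// !normrM (gtr0_norm l0) (gtr0_norm l1').
  by apply: lerD; apply: ler_wpM2l; rewrite ?gr ?hs ?(ltW l0) ?(ltW l1').
split.
  move=> _ [[[f A] e] [/= cA e0] <-]; rewrite openE => g [r re gr].
  apply/nbhs_entireP; exists A, ((e - r) / 2); split => //.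
    by rewrite divr_gt0 ?subr_gt0.
  move=> h /= hg; exists (r + (e - r) / 2).
    rewrite -ltrBrDl ltr_pdivrMr// mulr_natr mulr2n ltrDl.
    by rewrite subr_gt0.
  move=> x Ax; rewrite -(subrK (g x) (f x)) -addrA (le_trans (ler_normD _ _))//.
  by rewrite lerD ?gr// ltW// hg.
move=> f U /nbhs_entireP[A [e [cA e0 eU]]].
exists (V f A e) => /=.
  split; first by exists (f, A, e).
  by exists 0 => // x _; rewrite subrr normr0.
by move=> g [r re gr]; apply: eU => x Ax; exact: le_lt_trans (gr _ Ax) re.
Qed.

HB.instance Definition _ := PreTopologicalNmodule_isTopologicalNmodule.Build
  entire entire_add_continuous.
HB.instance Definition _ := TopologicalNmodule_isTopologicalLmodule.Build K
  entire entire_scale_continuous.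
HB.instance Definition _ := Uniform_isTvs.Build K entire entire_locally_convex.

End EntireFunctions.

Definition multiindex := {fsfun nat -> nat with 0%N}.

Section Multiindex.
Implicit Types alpha beta : multiindex.

Definition mdeg alpha := (\sum_(j <- finsupp alpha) alpha j)%N.

(* Basis vectors are indexed from 0, so len is shifted to keep len 0 = 0
   distinct from the length of multi-indices supported at the first vector. *)
Definition mlen alpha := (\max_(j <- finsupp alpha) j.+1)%N.

Definition square_lt alpha beta :=
  (mlen alpha < mlen beta)%N \/
  (mlen alpha = mlen beta /\
   exists j, [/\ alpha j <> beta j,
                 forall i, (j < i)%N -> alpha i = beta i &
                 (alpha j < beta j)%N]).

Definition compatible_enum (phi : nat -> multiindex) :=
  bijective phi /\
  forall n i j, mdeg (phi i) = n -> mdeg (phi j) = n ->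
    (i < j)%N <-> square_lt (phi i) (phi j).

End Multiindex.

Section Monomials.
Context (K : numFieldType) (X : normedModType K) (b : nat -> X).

Definition monomial_fun (alpha : multiindex) : X -> K^o :=
  fun x => \prod_(j <- finsupp alpha) coef b j x ^+ alpha j.

Context (bb : schauder_basis b).

Lemma coef_differentiable j x : differentiable (coef b j : X -> K^o) x.
Proof.
pose lM := GRing.isLinear.Build _ _ _ _ _ (coef_is_linear j bb).
pose L : {linear X -> K^o} := HB.pack (coef b j : X -> K^o) lM.
exact: (@linear_differentiable _ _ _ L x (proj2 bb j)).
Qed.

Lemma monomial_entire alpha : monomial_fun alpha \in @entire_pred K X.
Proof.
rewrite inE => x; rewrite /monomial_fun.
have -> : (fun x => \prod_(j <- finsupp alpha) coef b j x ^+ alpha j) =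
    \prod_(j <- finsupp alpha) ((coef b j : X -> K) ^+ alpha j : X -> K).
  by apply/funext => y; rewrite fct_prodE; under [RHS]eq_bigr do rewrite exprfctE.
elim/big_ind : _ => [|f g df dg|j _].
- exact: differentiable_cst.
- exact: differentiableM.
- elim: (alpha j) => [|n IH]; first by rewrite expr0; exact: differentiable_cst.
  by rewrite exprS; apply: differentiableM => //; exact: coef_differentiable.
Qed.

Definition monomial alpha : entire X := Entire (monomial_entire alpha).

End Monomials.

(* Main.v *)
Require Import Defs.
From mathcomp Require Import all_boot all_order all_algebra.
From mathcomp Require Import finmap cyclic separable cyclotomic complex.
From mathcomp Require Import all_classical all_reals all_analysis.
From mathcomp Require Import ring zify.

(** A sequence of entire functions is a Schauder basis for the compact-open
    topology if none of its terms vanishes, its span is dense, and its partial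
    sum operators, considered on finite sums only, are equicontinuous. This is
    [schauder_criterion]; for the monomials the last two conditions are
    [monomial_grunblum] and [monomial_dense].

    Equicontinuity. By 1-unconditionality every compact set A lies in a compact
    set stable under coordinatewise multiplication by scalars of modulus at most
    1 ([compact_solid_hull]). For fixed x in A a finite sum of monomials becomes
    a polynomial in the multipliers, so it suffices to bound sums of
    coefficients by the supremum over a polydisc. In one degree the square order
    is the colexicographic order, and an initial segment splits along the
    exponent of the last variable: it consists of at most n + 1 pieces, each
    obtained by Cauchy projections, so in degree n its norm is at most n + 1
    ([initial_bound]). Doubling the polydisc multiplies the part of degree n by
    2 ^ n, and the sum of the (n + 1) / 2 ^ n is 4; hence a partial sum in any
    compatible order is bounded on A by 4 times the supremum over twice the
    solid hull of A.

    Density. An entire function f is uniformly close on a compact set to its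
    composition with a truncation of the basis expansion, that is, to an entire
    function of finitely many variables. These are replaced by polynomials one
    variable at a time, by Newton interpolation ([entire_interpolation]): it
    uses only finitely many values, so the result remains entire in the other
    variables, and its error on a disc is controlled by the supremum of f on a
    larger disc.

    Interpolation. The divided differences of an entire function are bounded by
    the maximum principle, in a version allowing finitely many singularities
    ([maximum_off_finite]). It follows from the same principle with an extra
    constant 2 ([weak_maximum]), applied to high powers. The latter is a crude
    form of Cauchy's formula on a square, obtained from Goursat's bisection
    argument; integrals are replaced there by midpoint sums, which are exactly
    additive under bisection and exact on affine functions. *)

Set Implicit Arguments.
Unset Strict Implicit.
Unset Printing Implicit Defensive.

Import Order.TTheory GRing.Theory Num.Def Num.Theory.
Import numFieldNormedType.Exports.

Local Open Scope classical_set_scope.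
Local Open Scope ring_scope.

(** * Complex differentiable functions *)

Section ComplexDifferentiable.
Context (K : numFieldType).
Implicit Types (f g q : K^o -> K^o) (x y c : K^o).

Let cont_cst c x : {for x, continuous (fun=> c : K^o)}.
Proof. exact: cst_continuous. Qed.

Lemma continuous_epsP q x : {for x, continuous q} <->
  forall e : K, 0 < e -> exists2 d : K, 0 < d &
    forall y, `|y - x| < d -> `|q y - q x| < e.
Proof.
split=> [qx e e0|qx A /nbhs_ballP[e /= e0 eA]].
  have /nbhs_ballP[d /= d0 dq] : nbhs x [set y | `|q y - q x| < e].
    apply: (qx [set z | `|z - q x| < e]).
    by apply/nbhs_ballP; exists e => //= z; rewrite -ball_normE/= distrC.
  by exists d => // y yx; apply: dq; rewrite -ball_normE/= distrC.
have [d d0 dq] := qx e e0; apply/nbhs_ballP; exists d => //= y.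
rewrite -ball_normE/= distrC => /dq qyx.
by apply: eA; rewrite -ball_normE/= distrC.
Qed.

(** Complex differentiability in Caratheodory's form: the difference quotient at
    x extends continuously to x. Products and quotients become identities
    between continuous functions. *)
Definition cdiff f x := exists2 q : K^o -> K^o, {for x, continuous q} &
  forall y, f y = f x + q y * (y - x).

Lemma cdiff_continuous f x : cdiff f x -> {for x, continuous f}.
Proof.
move=> [q qx fq].
rewrite (_ : f = fun y => f x + q y * (y - x)); last exact/funext.
apply: continuousD; first exact: cont_cst.
apply: continuousM => //.
by apply: continuousB; [exact: cvg_id|exact: cont_cst].
Qed.

Lemma cdiff_cst c x : cdiff (fun=> c) x.
Proof. by exists (fun=> 0) => [|y]; [exact: cont_cst|rewrite mul0r addr0]. Qed.

Lemma cdiff_sub c x : cdiff (fun y => y - c) x.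
Proof. by exists (fun=> 1) => [|y]; [exact: cont_cst|ring]. Qed.

Lemma cdiffD f g x : cdiff f x -> cdiff g x -> cdiff (fun y => f y + g y) x.
Proof.
move=> [q qx fq] [r rx gr]; exists (fun y => q y + r y) => [|y].
  exact: continuousD.
by rewrite fq gr mulrDl addrACA.
Qed.

Lemma cdiffM f g x : cdiff f x -> cdiff g x -> cdiff (fun y => f y * g y) x.
Proof.
move=> df dg; have gx := cdiff_continuous dg.
move: df dg => [q qx fq] [r rx gr]; exists (fun y =>
  q y * g y + f x * r y) => [|y].
  by apply: continuousD; apply: continuousM => //; exact: cont_cst.
by rewrite (fq y) gr; ring.
Qed.

Lemma cdiffX f n x : cdiff f x -> cdiff (fun y => f y ^+ n) x.
Proof.
move=> df; elim: n => [|n ih]; first exact: cdiff_cst.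
by under eq_fun do rewrite exprS; exact: cdiffM.
Qed.

Lemma cdiff_prod (I : Type) (s : seq I) (F : I -> K^o -> K^o) x :
  (forall i, cdiff (F i) x) -> cdiff (fun y => \prod_(i <- s) F i y) x.
Proof.
move=> dF; elim: s => [|i s ih].
  by under eq_fun do rewrite big_nil; exact: cdiff_cst.
by under eq_fun do rewrite big_cons; exact: cdiffM.
Qed.

Lemma cdiffV f x : cdiff f x -> f x != 0 -> cdiff (fun y => (f y)^-1) x.
Proof.
move=> df fx0; have fx := cdiff_continuous df; case: df => q qx fq.
(* off the zeros of f the difference quotient of 1/f is - q / (f * f x) *)
exists (fun y => if f y ==
  0 then - (f x)^-1 / (y - x) else - (q y) / (f y * f x)) => [|y].
  have : {for x, continuous (fun y => - q y * (f y * f x)^-1)}.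
    apply: continuousM; first exact: continuousN.
    apply: continuousV; first by rewrite mulf_neq0.
    by apply: continuousM => //; exact: cont_cst.
  rewrite /prop_for/continuous_at (negPf fx0) => qcvg A /qcvg.
  have fnz : nbhs x [set y | f y != 0].
    apply: (fx [set z | z != 0]).
    apply/nbhs_ballP; exists `|f x| => [|z]; first by rewrite /= normr_gt0.
    by rewrite -ball_normE/=; apply: contraTneq => ->; rewrite subr0 ltxx.
  by apply: filterS2 fnz => y /= /negPf ->.
have [fy0|fy0] := eqVneq (f y) 0; last first.
  have [->|yx] := eqVneq y x; first by rewrite subrr mulr0 addr0.
  have yx0 : y - x != 0 by rewrite subr_eq0.
  have -> : q y = (f y - f x) / (y - x) by rewrite (fq y); field.
  by field; rewrite fx0 fy0 yx0.
have yx0 : y - x != 0.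
  by apply: contra_neq fx0 => /eqP; rewrite subr_eq0 => /eqP <-.
by rewrite fy0 invr0 divfK// subrr.
Qed.

(** This is how the exceptional points of the maximum principle are absorbed: a
    factor vanishing to second order makes any bounded singularity harmless. *)
Lemma cdiff_removable f (B r : K) x : 0 <= B -> 0 < r -> f x = 0 ->
  (forall y, `|y - x| < r -> `|f y| <= B * `|y - x| ^+ 2) -> cdiff f x.
Proof.
move=> B0 r0 fx0 fB; exists (fun y => f y / (y - x)) => [|y]; last first.
  have [->|yx] := eqVneq y x; first by rewrite subrr mulr0 addr0.
  by rewrite fx0 add0r divfK// subr_eq0.
apply/continuous_epsP => e e0; rewrite subrr invr0 mulr0.
have B10 : 0 < B + 1 by rewrite ltr_wpDl.
have [m m0 [mr me]] : exists2 m : K, 0 < m & m <= r /\ m <= e / (B + 1).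
  have e10 : 0 < e / (B + 1) by rewrite divr_gt0.
  have [re|/ltW er] := real_leP (gtr0_real r0) (gtr0_real e10);
    first by exists r.
  by exists (e / (B + 1)).
exists m => // y ym; rewrite subr0.
have [->|yx] := eqVneq y x; first by rewrite fx0 mul0r normr0.
have yx0 : 0 < `|y - x| by rewrite normr_gt0 subr_eq0.
rewrite normrM normfV ltr_pdivrMr//.
rewrite (le_lt_trans (fB _ (lt_le_trans ym mr)))// expr2 mulrA ltr_pM2r//.
rewrite (@lt_le_trans _ _ ((B + 1) * `|y - x|))//.
  by rewrite ltr_pM2r// ltrDl.
by rewrite mulrC -ler_pdivlMr// (le_trans (ltW ym)).
Qed.
End ComplexDifferentiable.

Lemma differentiable_line (K : numFieldType) (X : normedModType K)
    (f : X -> K^o) (x h : X) (t : K) : differentiable f (x + t *: h) ->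
  cdiff (fun s => f (x + s *: h)) t.
Proof.
move=> /(@diff_derivable _ _ _ _ _ h)/cvg_ex[d dP].
exists (fun s => if s == t then d else (s - t)^-1 * (f (x + s *: h) - f (x +
  t *: h))).
  apply/continuous_epsP => e e0; rewrite eqxx.
  have /cvgrPdist_lt/(_ e e0)/nbhs_ballP[del /= del0 H] := dP.
  exists del => // s st; case: eqVneq => [_|sNt]; first by rewrite subrr normr0.
  have := H (s - t); rewrite /ball/= sub0r normrN subr_eq0 => /(_ st sNt).
  by rewrite distrC addrCA -scalerDl subrK.
move=> s; case: eqVneq => [->|st]; first by rewrite subrr mulr0 addr0.
by field; rewrite subr_eq0.
Qed.

(** * Midpoint sums along segments and parallelograms *)

Section MidpointSums.
Context (K : numClosedFieldType).
Implicit Types (f g : K -> K) (a u v w c d p : K) (n : nat).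

(** The composite midpoint rule with 2 ^ n equal steps on the segment from a to
    a + w, approximating the integral of f. Three properties make it a
    substitute for the integral in Goursat's argument without any passage to the
    limit: refinement is exact under bisection, affine functions are integrated
    exactly, and the length bound holds at every level n. *)
Fixpoint midpoint_sum n f a w : K :=
  if n is n'.+1 then
    midpoint_sum n' f a (w / 2) + midpoint_sum n' f (a + w / 2) (w / 2)
  else f (a + w / 2) * w.

Lemma eq_midpoint_sum n f g a w : f =1 g ->
  midpoint_sum n f a w = midpoint_sum n g a w.
Proof. by move=> /funext ->. Qed.

Lemma midpoint_sumD n f g a w :
  midpoint_sum n (fun z => f z + g z) a w =
    midpoint_sum n f a w + midpoint_sum n g a w.
Proof.
by elim: n a w => [|n ih] a w /=; rewrite ?mulrDl// !ih addrACA.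
Qed.

Lemma midpoint_sumZ n c f a w :
  midpoint_sum n (fun z => c * f z) a w = c * midpoint_sum n f a w.
Proof. by elim: n a w => [|n ih] a w /=; rewrite ?mulrA// !ih mulrDr. Qed.

Lemma midpoint_sum_affine n c d p a w :
  midpoint_sum n (fun z => c + d * (z - p)) a w = (c + d * (a + w / 2 - p)) * w.
Proof. by elim: n a w => [|n ih] a w //=; rewrite !ih; field. Qed.

Lemma midpoint_sum_le n f a w c :
  (forall t : K, 0 <= t <= 1 -> `|f (a + t * w)| <= c) ->
  `|midpoint_sum n f a w| <= c * `|w|.
Proof.
elim: n a w => [|n ih] a w fc /=.
  rewrite normrM ler_wpM2r// [w / 2]mulrC fc// invr_ge0 ler0n/=.
  by rewrite invf_le1// ler1n.
have w2 : c * `|w| = c * `|w / 2| + c * `|w / 2|.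
  by rewrite normrM normfV normr_nat; field.
rewrite w2 (le_trans (ler_normD _ _))// lerD// ih// => t /andP[t0 t1].
  rewrite (_ : t * (w / 2) = t / 2 * w); last by field.
  by rewrite fc// divr_ge0//= ler_pdivrMr// mul1r (le_trans t1)// ler1n.
rewrite -addrA (_ : w / 2 + t * (w / 2) = (1 + t) / 2 * w); last by field.
rewrite fc// divr_ge0 ?addr_ge0//= ler_pdivrMr// mul1r.
by rewrite [leRHS](_ : _ = 1 + 1)// lerD2l.
Qed.

(** Used to bound from below the winding number integral of 1 / (z - p). *)
Lemma midpoint_sum_Im_ge n f a w c :
  (forall t : K, 0 <= t <= 1 -> c <= 'Im (f (a + t * w) * w)) ->
  c <= 'Im (midpoint_sum n f a w).
Proof.
elim: n a w c => [|n ih] a w c fc /=.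
  rewrite [w / 2]mulrC fc// invr_ge0 ler0n/=.
  by rewrite invf_le1// ler1n.
have halfIm z : 'Im (z * (w / 2)) = 'Im (z * w) / 2.
  by rewrite mulrA ImMr// realV realn.
have c2 : c = c / 2 + c / 2 by field.
rewrite c2 raddfD/= lerD// ih// => t /andP[t0 t1];
  rewrite halfIm ler_pM2r ?invr_gt0//.
  rewrite (_ : t * (w / 2) = t / 2 * w); last by field.
  by rewrite fc// divr_ge0//= ler_pdivrMr// mul1r (le_trans t1)// ler1n.
rewrite -addrA (_ : w / 2 + t * (w / 2) = (1 + t) / 2 * w); last by field.
rewrite fc// divr_ge0 ?addr_ge0//= ler_pdivrMr// mul1r.
by rewrite [leRHS](_ : _ = 1 + 1)// lerD2l.
Qed.

(** The midpoint approximation of the integral of f along the boundary of the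
    parallelogram with corner a and edges u and v. *)
Definition boundary_sum n f a u v :=
  midpoint_sum n f a u + midpoint_sum n f (a + u) v
  - midpoint_sum n f (a + v) u - midpoint_sum n f a v.

(** The contributions of the interior edges of the four quarters cancel. *)
Lemma boundary_sumS n f a u v : let u' := u / 2 in let v' := v / 2 in
  boundary_sum n.+1 f a u v =
    boundary_sum n f a u' v' + boundary_sum n f (a + u') u' v' +
    boundary_sum n f (a + v') u' v' + boundary_sum n f (a + u' + v') u' v'.
Proof.
move=> u' v'; rewrite /boundary_sum/= -/u' -/v'.
have -> : a + u' + u' = a + u by rewrite /u'; field.
have -> : a + v' + v' = a + v by rewrite /v'; field.
have -> : a + u' + v' + u' = a + u + v' by rewrite /u'; field.
have -> : a + u' + v' + v' = a + v + u' by rewrite /v'; field.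
by rewrite [a + v' + u']addrAC; ring.
Qed.

Lemma boundary_sumB n f g a u v :
  boundary_sum n (fun z => f z - g z) a u v =
    boundary_sum n f a u v - boundary_sum n g a u v.
Proof.
have midB b w : midpoint_sum n (fun z => f z - g z) b w =
  midpoint_sum n f b w - midpoint_sum n g b w.
  rewrite -[RHS](congr1 (+%R _) (mulN1r _)) -midpoint_sumZ -midpoint_sumD.
  by apply: eq_midpoint_sum => z; rewrite mulN1r.
by rewrite /boundary_sum !midB; ring.
Qed.

Lemma boundary_sum_affine n c d p a u v :
  boundary_sum n (fun z => c + d * (z - p)) a u v = 0.
Proof. by rewrite /boundary_sum !midpoint_sum_affine; field. Qed.

Lemma boundary_sum_le n f a u v c :
  (forall s t : K, 0 <= s <= 1 -> 0 <= t <= 1 ->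
    `|f (a + s * u + t * v)| <= c) ->
  `|boundary_sum n f a u v| <= 2 * c * (`|u| + `|v|).
Proof.
move=> fc; have I0 : 0 <= (0 : K) <= 1 by rewrite lexx ler01.
have I1 : 0 <= (1 : K) <= 1 by rewrite lexx ler01.
have -> : 2 * c * (`|u| + `|v|) = c * `|u| + c * `|v| + c * `|u| + c * `|v|.
  by ring.
rewrite /boundary_sum (le_trans (ler_normB _ _))// lerD//.
  rewrite (le_trans (ler_normB _ _))// lerD// ?(le_trans (ler_normD _ _))//
    ?lerD//.
- by apply: midpoint_sum_le => t It; rewrite -[_ + _]addr0 -(mul0r v) fc.
- by apply: midpoint_sum_le => t It; rewrite -[u in a + u]mul1r fc.
- by apply: midpoint_sum_le => t It; rewrite addrAC -[v in _ + v]mul1r fc.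
- by apply: midpoint_sum_le => t It; rewrite -[a]addr0 -(mul0r u) fc.
Qed.
End MidpointSums.

(** * Completeness of the scalars *)

Section RealCompleteness.
Context (K : numClosedFieldType).

(** Completeness of the real axis of K, in the form used by bisection; the order
    of K compares only numbers with the same imaginary part, so the bounds lie
    on one horizontal line. *)
Definition interval_complete := forall lo hi : nat -> K,
  (forall k l, lo k <= hi l) -> exists t, forall k, lo k <= t <= hi k.

Definition archimedean_norm := forall x : K, 0 <= x -> exists n : nat, x < n%:R.

Lemma archimedean_exp (Ka : archimedean_norm) (c e : K) : 0 <= c -> 0 < e ->
  exists n : nat, c / 2 ^+ n < e.
Proof.
move=> c0 e0; have [|n cn] := Ka (c / e); first by rewrite divr_ge0// ltW.
exists n; rewrite ltr_pdivrMr ?exprn_gt0// mulrC -ltr_pdivrMr//.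
by rewrite (lt_trans cn)// -natrX ltr_nat ltn_expl.
Qed.

(** Apply interval completeness to the real and to the imaginary parts; the two
    errors add up, hence the factor 2. *)
Lemma interval_cauchy (Kc : interval_complete) (z e : nat -> K) :
  (forall k l, `|z k - z l| <= e k + e l) ->
  exists w, forall k, `|w - z k| <= 2 * e k.
Proof.
move=> ze; have e_real k : e k \is Num.real.
  have := le_trans (normr_ge0 _) (ze k k); rewrite -mulr2n -mulr_natr.
  by rewrite pmulr_lge0// => /ger0_real.
have part (p : K -> K) : (forall x, p x \is Num.real) ->
    (forall x y, p (x - y) = p x - p y) -> (forall x, `|p x| <= `|x|) ->
    exists t, t \is Num.real /\ forall k, `|t - p (z k)| <= e k.
  move=> p_real pB p_le.
  have [|t tP] := Kc (fun k => p (z k) - e k) (fun k => p (z k) + e k).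
    move=> k l; rewrite lerBlDr -addrA [e l + _]addrC -lerBlDl.
    rewrite -pB (le_trans _ (ze k l))// (le_trans _ (p_le _))//.
    exact: real_ler_norm.
  have t_real : t \is Num.real.
    by have /andP[/ler_real <- _] := tP 0%N; rewrite realB.
  exists t; split=> // k.
  by rewrite real_ler_distl ?tP// realB.
have Im_le (x : K) : `|'Im x| <= `|x|.
  by rewrite -normrN -ReMil (le_trans (leif_normC_Re_Creal _).1)//
    normrM normCi mul1r.
have [x [x_real xP]] := part _ (@Creal_Re K) (raddfB _) (fun x =>
  (leif_normC_Re_Creal x).1).
have [y [y_real yP]] := part _ (@Creal_Im K) (raddfB _) Im_le.
exists (x + 'i * y) => k; rewrite {1}[z k]Crect.
rewrite opprD addrACA -mulrBr (le_trans (ler_normD _ _))// mulr2n mulrDl mul1r.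
by rewrite lerD// normrM normCi mul1r.
Qed.
End RealCompleteness.

(** * Goursat's theorem *)

Section Goursat.
Context (K : numClosedFieldType).
Hypotheses (Kc : interval_complete K) (Ka : archimedean_norm K).
Implicit Types (f g : K -> K) (a u v z : K).

Definition small_boundary_sum (e : K) f a u v := exists N : nat, forall n : nat,
  (N <= n)%N -> `|boundary_sum n f a u v| <= e.

Lemma small_boundary_sumS (e1 e2 e3 e4 : K) f a u v :
  let u' := u / 2 in let v' := v / 2 in
  small_boundary_sum e1 f a u' v' -> small_boundary_sum e2 f (a + u') u' v' ->
  small_boundary_sum e3 f (a + v') u' v' ->
  small_boundary_sum e4 f (a + u' + v') u' v' ->
  small_boundary_sum (e1 + e2 + e3 + e4) f a u v.
Proof.
move=> u' v' [N1 b1] [N2 b2] [N3 b3] [N4 b4].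
exists (N1 + N2 + N3 + N4).+1 => -[//|n]; rewrite ltnS => Nn.
have [n1 n2 n3 n4] : [/\ N1 <= n, N2 <= n, N3 <= n & N4 <= n]%N by split; lia.
rewrite boundary_sumS (le_trans (ler_normD _ _))// lerD ?b4//.
rewrite (le_trans (ler_normD _ _))// lerD ?b3//.
by rewrite (le_trans (ler_normD _ _))// lerD ?b1 ?b2.
Qed.

Lemma small_boundary_sum_le (e e' : K) f a u v : e <= e' ->
  small_boundary_sum e f a u v -> small_boundary_sum e' f a u v.
Proof. by move=> ee' [N bN]; exists N => n /bN/le_trans; apply. Qed.

Lemma dist_le_itv (x y h : K) : 0 <= x <= h -> 0 <= y <= h -> `|x - y| <= h.
Proof.
move=> /andP[x0 xh] /andP[y0 yh].
rewrite real_ler_distl ?realB ?ger0_real// lerBlDr.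
by rewrite (le_trans yh) ?lerDr// (le_trans xh)// lerDr.
Qed.

(** Near a point of differentiability f is affine up to an error that is small
    compared with the distance, and affine functions contribute nothing; so the
    boundary sums of small parallelograms around the point are small compared
    with the square of their size. *)
Lemma small_boundary_sum_cdiff f a u v (s t : K) :
  cdiff f (a + s * u + t * v) ->
  forall e : K, 0 < e -> exists2 d : K, 0 < d & forall (h s' t' : K),
    s' <= s <= s' + h -> t' <= t <= t' + h -> h * (`|u| + `|v|) < d ->
    small_boundary_sum (e * (h * (`|u| + `|v|)) ^+ 2) f (a + s' * u + t' * v)
      (h * u) (h * v).
Proof.
set p := a + _ + _ => -[q /continuous_epsP qc fq] e e0.
have [d d0 dq] := qc (e / 2) (divr_gt0 e0 (ltr0n _ 2)).
exists d => // h s' t' /andP[ss' ssh] /andP[tt' tth] hd; exists 0%N => n _.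
set D := h * _ in hd *.
have h0 : 0 <= h by rewrite -(lerDl s') (le_trans ss').
rewrite -[boundary_sum _ _ _ _ _]subr0 -(boundary_sum_affine n (f p) (q p) p
  (a + s' * u + t' * v) (h * u) (h * v)).
rewrite -boundary_sumB [leRHS](_ : _ =
  2 * (e / 2 * D) * (`|h * u| + `|h * v|)); last first.
  by rewrite !normrM (ger0_norm h0) -mulrDr -/D; field.
apply: boundary_sum_le => x y /andP[x0 x1] /andP[y0 y1]; set z :=
  a + _ + _ + _ + _.
have zpD : `|z - p| <= D.
  have -> : z - p = (x * h - (s - s')) * u + (y * h - (t - t')) * v.
    by rewrite /z /p; ring.
  rewrite (le_trans (ler_normD _ _))// !normrM /D mulrDr lerD// ler_wpM2r//;
    apply: dist_le_itv; rewrite ?subr_ge0 ?lerBlDl ?ss' ?tt' ?ssh ?tth//;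
    by rewrite mulr_ge0//= ler_piMl.
have -> : f z - (f p + q p * (z - p)) = (q z - q p) * (z - p).
  by rewrite (fq z); ring.
by rewrite normrM ler_pM// ltW// dq// (le_lt_trans zpD).
Qed.

(** The corners chosen by successive bisection converge to a point of all the
    intervals. *)
Lemma nested_halving (x : nat -> K) : (forall k, x k.+1 = x k \/
    x k.+1 = x k + 2^-1 ^+ k.+1) ->
  exists s, forall k, x k <= s <= x k + 2^-1 ^+ k.
Proof.
move=> xS; have h0 k : 0 <= 2^-1 ^+ k :> K by rewrite exprn_ge0// invr_ge0.
have hS k : 2^-1 ^+ k = 2^-1 ^+ k.+1 + 2^-1 ^+ k.+1 :> K by rewrite exprS;
  field.
have lo k d : x k <= x (k + d)%N.
  elim: d => [|d ih]; first by rewrite addn0.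
  by rewrite addnS (le_trans ih)//; case: (xS (k + d)%N) => ->//; rewrite lerDl.
have hi k d : x (k + d)%N + 2^-1 ^+ (k + d) <= x k + 2^-1 ^+ k.
  elim: d => [|d ih]; first by rewrite addn0.
  rewrite addnS (le_trans _ ih)// [in leRHS]hS.
  by case: (xS (k + d)%N) => ->; rewrite addrA// lerDl.
apply: Kc => k l; have [kl|/ltnW lk] := leqP k l.
  by rewrite -(subnKC kl) (le_trans (lo k (l - k)%N))// lerDl.
by rewrite -(subnKC lk) (le_trans _ (hi l (k - l)%N))// lerDl.
Qed.

(** Goursat's bisection: a bound on the boundary sums proportional to the square
    of the size passes from the four quarters to the whole. If it failed for the
    parallelogram it would fail for arbitrarily small parallelograms shrinking
    to one of its points, where f is differentiable. *)
Lemma goursat f a u v :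
  (forall s t : K, 0 <= s <= 1 -> 0 <= t <= 1 -> cdiff f (a + s * u + t * v)) ->
  forall e : K, 0 < e -> small_boundary_sum e f a u v.
Proof.
move=> df e e0; apply: contrapT => notsmall.
set D := `|u| + `|v|; have D0 : 0 <= D by rewrite addr_ge0.
(* D may be 0; the bound c * D ^ 2 is at most e *)
pose c := e / (D ^+ 2 + 1).
have D1 : 0 < D ^+ 2 + 1 by rewrite ltr_wpDl// exprn_ge0.
have c0 : 0 < c by rewrite divr_gt0.
pose h k : K := 2^-1 ^+ k.
have hS k : h k = 2 * h k.+1 by rewrite /h exprS; field.
pose bad (k : nat) (x : K * K) :=
  ~ small_boundary_sum (c * (h k * D) ^+ 2) f (a + x.1 * u +
    x.2 * v) (h k * u) (h k * v).
have step (kx : nat * (K * K)) : exists y : K * K, bad kx.1 kx.2 ->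
    [/\ bad kx.1.+1 y, y.1 = kx.2.1 \/ y.1 = kx.2.1 + h kx.1.+1 &
      y.2 = kx.2.2 \/ y.2 = kx.2.2 + h kx.1.+1].
  case: kx => k [s t] /=; apply: contrapT => nostep.
  have good y : y.1 = s \/ y.1 = s + h k.+1 -> y.2 = t \/ y.2 = t + h k.+1 ->
      small_boundary_sum (c * (h k.+1 * D) ^+ 2) f (a + y.1 * u + y.2 * v)
        (h k.+1 * u) (h k.+1 * v).
    by move=> y1 y2; apply: contrapT => bady; apply: nostep; exists y.
  apply: nostep; exists (0, 0) => badst; exfalso; apply: badst => /=.
  have eqh w : h k * w / 2 = h k.+1 * w by rewrite hS; field.
  rewrite (_ : c * _ = c * (h k.+1 * D) ^+ 2 + c * (h k.+1 * D) ^+ 2 +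
    c * (h k.+1 * D) ^+ 2 + c * (h k.+1 * D) ^+ 2); last by rewrite hS; ring.
  apply: small_boundary_sumS; rewrite !eqh.
  - by have := good (s, t); apply; left.
  - have := good (s + h k.+1, t); rewrite /= mulrDl addrA [_ + _ + t * v]addrAC.
    by apply; [right|left].
  - have := good (s, t + h k.+1); rewrite /= [(t + _) * v]mulrDl addrA.
    by apply; [left|right].
  - have := good (s + h k.+1, t + h k.+1).
    rewrite /= !mulrDl !addrA [_ + _ + t * v]addrAC.
    by apply; right.
have [F FP] := choice step.
pose x k := iteri k (fun k y => F (k, y)) (0, 0).
have xbad k : bad k (x k).
  elim: k => [|k ih]; last by have [] := FP (k, x k) ih.
  rewrite /bad /= !mul0r !addr0 /h expr0 !mul1r => sm; apply: notsmall.
  by apply: small_boundary_sum_le sm; rewrite /c mulrAC ler_pdivrMr//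
    ler_pM2l// lerDl ler01.
have [|s sP] := @nested_halving (fun k => (x k).1).
  by move=> k; have [_ + _] := FP (k, x k) (xbad k).
have [|t tP] := @nested_halving (fun k => (x k).2).
  by move=> k; have [_ _ +] := FP (k, x k) (xbad k).
have := df s t; have := sP 0%N; have := tP 0%N.
rewrite /= !add0r !expr0 => t01 s01 /(_ s01 t01) dfst.
have [d d0 dP] := small_boundary_sum_cdiff dfst c0.
have [k kd] := archimedean_exp Ka D0 d0.
by apply: (xbad k); apply: dP => //; rewrite /h exprVn mulrC.
Qed.
End Goursat.

(** * The maximum principle up to a constant *)

Section WeakMaximum.
Context (K : numClosedFieldType).
Hypotheses (Kc : interval_complete K) (Ka : archimedean_norm K).
Implicit Types (f g : K -> K) (a u v z : K).

Lemma rect_eq0 (x y : K) : 0 <= x -> 0 <= y -> x + 'i * y = 0 -> x = 0 /\ y = 0.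
Proof.
move=> /ger0_real xr /ger0_real yr xy0.
have := Re_rect xr yr; have := Im_rect xr yr.
by rewrite xy0 !raddf0.
Qed.

(** A singularity of f at the corner z does no harm as long as f stays bounded
    there: under repeated bisection only one quarter contains z, the others
    contribute nothing in the limit, and the length bound makes the boundary
    sums of the small parallelograms at z small. *)
Lemma goursat_corner f z u (M d : K) : u != 0 -> 0 < d -> 0 <= M ->
  (forall y, y != z -> cdiff f y) -> (forall y, `|y - z| < d -> `|f y| <= M) ->
  forall e : K, 0 < e -> small_boundary_sum e f z u ('i * u).
Proof.
move=> u0 d0 M0 df fM.
have claim k (b : K) : forall u, u != 0 ->
    small_boundary_sum b f z (u / 2 ^+ k) ('i * (u / 2 ^+ k)) ->
    forall e : K, 0 < e -> small_boundary_sum (b + e) f z u ('i * u).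
  elim: k => [|k ih] {u0}u u0 bk e e0.
    by move: bk; rewrite expr0 divr1; apply: small_boundary_sum_le;
      rewrite lerDl ltW.
  have e40 : 0 < e / 4 by rewrite divr_gt0.
  have u20 : u / 2 != 0 by rewrite mulf_neq0// invr_neq0// pnatr_eq0.
  rewrite (_ : b + e = (b + e / 4) + e / 4 + e / 4 + e / 4); last by field.
  have off (x y : K) : 0 <= x -> 0 <= y -> x + 'i * y != 0 ->
      z + (x + 'i * y) * (u / 2) != z.
    by move=> x0 y0 xy0; rewrite -subr_eq0 addrAC subrr add0r mulf_neq0.
  have iu2 : 'i * u / 2 = 'i * (u / 2) by rewrite mulrA.
  apply: small_boundary_sumS; rewrite iu2.
  - apply: ih => //.
    by rewrite (_ : u / 2 / 2 ^+ k = u / 2 ^+ k.+1)// exprS; field;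
      rewrite expf_neq0.
  - apply: goursat => // s t /andP[s0 _] /andP[t0 _]; apply: df.
    rewrite (_ : _ + _ + _ = z + ((1 + s) + 'i * t) * (u / 2)); last by ring.
    have s1 : 0 <= 1 + s by rewrite addr_ge0.
    apply: off => //; apply/eqP => /(rect_eq0 s1 t0)[/eqP + _].
    by rewrite gt_eqF// ltr_pwDl.
  - apply: goursat => // s t /andP[s0 _] /andP[t0 _]; apply: df.
    rewrite (_ : _ + _ + _ = z + (s + 'i * (1 + t)) * (u / 2)); last by ring.
    have t1 : 0 <= 1 + t by rewrite addr_ge0.
    apply: off => //; apply/eqP => /(rect_eq0 s0 t1)[_ /eqP].
    by rewrite gt_eqF// ltr_pwDl.
  - apply: goursat => // s t /andP[s0 _] /andP[t0 _]; apply: df.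
    rewrite (_ : _ + _ + _ = z + ((1 + s) + 'i * (1 + t)) * (u / 2));
      last by ring.
    have s1 : 0 <= 1 + s by rewrite addr_ge0.
    have t1 : 0 <= 1 + t by rewrite addr_ge0.
    apply: off => //; apply/eqP => /(rect_eq0 s1 t1)[/eqP + _].
    by rewrite gt_eqF// ltr_pwDl.
move=> e e0; pose c := 4 * M * `|u| / (e / 2) + 2 * `|u| / d.
have e20 : 0 < e / 2 by rewrite divr_gt0.
have c10 : 0 <= 4 * M * `|u| / (e / 2) by rewrite divr_ge0 ?mulr_ge0// ltW.
have c20 : 0 <= 2 * `|u| / d by rewrite divr_ge0 ?mulr_ge0// ltW.
have [k ck] := archimedean_exp Ka (addr_ge0 c10 c20) (ltr01 : 0 < (1 : K)).
have k0 : 0 < 2 ^+ k :> K by rewrite exprn_gt0.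
move: ck; rewrite ltr_pdivrMr// mul1r => ck.
rewrite [e]splitr; apply: (claim k) => //; exists 0%N => n _.
have iE : `|'i * (u / 2 ^+ k)| = `|u / 2 ^+ k| by rewrite normrM normCi mul1r.
have uE : `|u / 2 ^+ k| = `|u| / 2 ^+ k by
  rewrite normrM normfV (ger0_norm (ltW k0)).
apply: (@le_trans _ _ (2 * M * (`|u / 2 ^+ k| + `|'i * (u / 2 ^+ k)|))).
  apply: boundary_sum_le => s t /andP[s0 s1] /andP[t0 t1]; apply: fM.
  rewrite (_ : _ - z = s * (u / 2 ^+ k) + t * ('i * (u / 2 ^+ k)));
    last by ring.
  rewrite (le_lt_trans (ler_normD _ _))//
    normrM uE (normrM t) iE uE (ger0_norm s0) (ger0_norm t0).
  rewrite (@le_lt_trans _ _ (2 * `|u| / 2 ^+ k))//; last first.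
    rewrite ltr_pdivrMr// [d * _]mulrC -ltr_pdivrMr// (le_lt_trans _ ck)//.
    by rewrite lerDr.
  rewrite -mulrA mulr2n mulrDl !mul1r lerD// ler_piMl// divr_ge0// ltW//.
rewrite iE uE [leLHS](_ : _ = 4 * M * `|u| / 2 ^+ k); last by field;
  rewrite gt_eqF.
rewrite ler_pdivrMr// [e / 2 * _]mulrC -ler_pdivrMr// (le_trans _ (ltW ck))//.
by rewrite lerDl.
Qed.

(** The boundary of the square with centre z and half-sides s and 'i * s, cut
    into eight segments: the outer edges of the four squares with common corner
    z. *)
Definition square_sum n f z s : K :=
  let side u :=
    midpoint_sum n f (z + u) ('i * u) - midpoint_sum n f (z + 'i * u) u in
  side s + side ('i * s) + side (- s) + side (- ('i * s)).

(** The edges issuing from z cancel. *)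
Lemma boundary_sum_square n f z s :
  boundary_sum n f z s ('i * s) + boundary_sum n f z ('i * s) ('i * ('i * s)) +
  boundary_sum n f z (- s) ('i * - s) +
  boundary_sum n f z (- ('i * s)) ('i * - ('i * s)) = square_sum n f z s.
Proof.
have ii : 'i * ('i * s) = - s by rewrite mulrA -expr2 sqrCi mulN1r.
by rewrite /square_sum /boundary_sum !mulrN ii !opprK; ring.
Qed.

Lemma square_sum_small f z (s M d : K) : s != 0 -> 0 < d -> 0 <= M ->
  (forall y, y != z -> cdiff f y) -> (forall y, `|y - z| < d -> `|f y| <= M) ->
  forall e : K, 0 < e -> exists n, `|square_sum n f z s| <= e.
Proof.
move=> s0 d0 M0 df fM e e0; have e4 : 0 < e / 4 by rewrite divr_gt0.
have small u : u != 0 -> small_boundary_sum (e / 4) f z u ('i * u).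
  by move=> u0; apply: (goursat_corner u0 d0 M0 df fM).
have is0 : 'i * s != 0 by rewrite mulf_neq0// neq0Ci.
have [N1 b1] := small _ s0; have [N2 b2] := small _ is0.
have [|N3 b3] := small (- s); first by rewrite oppr_eq0.
have [|N4 b4] := small (- ('i * s)); first by rewrite oppr_eq0.
pose n := (N1 + N2 + N3 + N4)%N.
have [n1 n2 n3 n4] : [/\ N1 <= n, N2 <= n, N3 <= n & N4 <= n]%N by split; lia.
exists n; rewrite -boundary_sum_square (_ : e =
  e / 4 + e / 4 + e / 4 + e / 4); last by field.
rewrite (le_trans (ler_normD _ _))// lerD ?b4//.
rewrite (le_trans (ler_normD _ _))// lerD ?b3//.
by rewrite (le_trans (ler_normD _ _))// lerD ?b1 ?b2.
Qed.

Lemma side_norm (t : K) : 0 <= t <= 1 ->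
  (1 <= `|1 + 'i * t| <= 2) && (1 <= `|t + 'i * 1| <= 2).
Proof.
move=> /andP[t0 t1]; have tr := ger0_real t0.
have t2 : 0 <= t ^+ 2 <= 1 by rewrite exprn_ge0//= exprn_ile1.
have sq (x : K) : 0 <= x -> x ^+ 2 = 1 + t ^+ 2 -> 1 <= x <= 2.
  move=> x0 xE; rewrite -(ler_pXn2r (_ : 0 < 2)%N)// ?nnegrE// xE expr1n.
  rewrite -[X in _ && X](ler_pXn2r (_ : 0 < 2)%N)// ?nnegrE// xE.
  case/andP: t2 => t20 t21;
    rewrite lerDl t20/= (le_trans (lerD (lexx 1) t21))//.
  by rewrite -natrX -(natrD _ 1 1) ler_nat.
by rewrite !sq// normC2_rect ?real1// expr1n// addrC.
Qed.

(** On each of the eight segments the kernel times the edge, taken with its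
    orientation, equals (x + 'i) / (1 + t ^ 2) with x = t or x = - t, and t in
    [0, 1]; hence its imaginary part is at least 1/2. *)
Lemma side_kernel z u (t : K) : u != 0 -> 0 <= t <= 1 ->
  2^-1 <= 'Im ((z + u + t * ('i * u) - z)^-1 * ('i * u)) /\
  2^-1 <= 'Im (- (z + 'i * u + t * u - z)^-1 * u).
Proof.
move=> u0 t01; have /andP[t0 t1] := t01; have tr := ger0_real t0.
have /andP[/andP[n1 _] /andP[n2 _]] := side_norm t01.
have t2 : 0 <= t ^+ 2 <= 1 by rewrite exprn_ge0//= exprn_ile1.
have d0 : 0 < 1 + t ^+ 2 by rewrite ltr_pwDl//; case/andP: t2.
have nz (x : K) : 1 <= `|x| -> x != 0.
  by move=> x1; rewrite -normr_gt0 (lt_le_trans ltr01).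
have dn0 : 1 + t ^+ 2 != 0 by rewrite gt_eqF.
have := nz _ n1; have := nz _ n2; move=> {}n2 {}n1.
have ImE (x : K) : x \is Num.real -> 'Im ((x + 'i * 1) / (1 + t ^+ 2)) =
  (1 + t ^+ 2)^-1.
  by move=> xr; rewrite ImMr ?Im_rect ?mul1r// ?real1//
    realV realD ?real1 ?realX.
have le2 : 2^-1 <= (1 + t ^+ 2)^-1.
  rewrite lef_pV2 ?posrE// [leRHS](_ : _ = 1 + 1)// lerD2l.
  by case/andP: t2.
have i2 : 'i ^+ 2 = -1 :> K by exact: sqrCi.
split.
  rewrite [X in 'Im X](_ : _ = (t + 'i * 1) / (1 + t ^+ 2)) ?ImE//.
  rewrite (_ : z + u + _ - z = u * (1 + 'i * t)); last by ring.
  apply/eqP; rewrite mulrC eqr_div ?mulf_neq0//; apply/eqP.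
  transitivity ('i * u * (1 + t ^+ 2) + u * t * (1 + 'i ^+ 2)); last by ring.
  by rewrite i2 subrr mulr0 addr0.
rewrite [X in 'Im X](_ : _ = (- t + 'i * 1) / (1 + t ^+ 2)) ?ImE ?realN//.
rewrite (_ : z + 'i * u + _ - z = u * (t + 'i * 1)); last by ring.
rewrite mulNr mulrC -mulrN; apply/eqP.
rewrite -invrN eqr_div ?oppr_eq0 ?mulf_neq0//; apply/eqP.
transitivity (u * (1 + t ^+ 2) - u * (1 + 'i ^+ 2)); last by ring.
by rewrite i2 subrr mulr0 subr0.
Qed.

(** Cauchy's integral formula on a square centred at z, up to a constant: the
    boundary sums of (f y - f z) / (y - z) tend to 0, those of 1 / (y - z) have
    imaginary part at least 8 * 1/2 = 4, and those of f y / (y - z) are at most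
    8 * m. The constant 2 is harmless, because the estimate is applied to powers
    of a function below. *)
Lemma weak_maximum f (R m : K) z : 0 < R -> `|z| < R ->
  (forall y, cdiff f y) -> (forall y, 2 * R <= `|y| <= 7 * R -> `|f y| <= m) ->
  `|f z| <= 2 * m.
Proof.
(* the boundary of the square with half-side 3 * R and centre z keeps a distance
   between 3 * R and 6 * R from z, hence between 2 * R and 7 * R from 0 *)
move=> R0 zR df fm; pose s := 3 * R.
have s0 : s != 0 by rewrite mulf_neq0 ?gt_eqF.
pose k y := (y - z)^-1; pose F y := (f y - f z) * k y.
have [q qc fq] := df z.
have [d d0 dq] := (continuous_epsP _ _).1 qc 1 ltr01.
have dF y : y != z -> cdiff F y.
  move=> yz; apply: cdiffM; first by apply: cdiffD => //; exact: cdiff_cst.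
  by apply: cdiffV; [exact: cdiff_sub|rewrite subr_eq0].
have F_le y : `|y - z| < d -> `|F y| <= `|q z| + 1.
  move=> yd; rewrite /F /k (fq y) addrAC subrr add0r.
  have [->|yz] := eqVneq y z;
    first by rewrite subrr mulr0 mul0r normr0 addr_ge0.
  rewrite mulfK ?subr_eq0// -(subrK (q z) (q y)) addrC.
  by rewrite (le_trans (ler_normD _ _))// lerD2l ltW// dq.
have Fpos : 0 <= `|q z| + 1 by rewrite addr_ge0.
have side_le n u : `|u| = s ->
    `|midpoint_sum n (fun y => f y * k y) (z + u) ('i * u)| <= m /\
    `|midpoint_sum n (fun y => f y * k y) (z + 'i * u) u| <= m.
  move=> us; have u0 : 0 < `|u| by rewrite us mulr_gt0.
  have u0' : u != 0 by rewrite -normr_gt0.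
  have key (x : K) : 1 <= `|x| <= 2 -> `|f (z + x * u) * k (z + x * u)| <=
    m / s.
    move=> /andP[x1 x2]; have xu : s <= `|x * u| <= 2 * s.
      by rewrite normrM us ler_peMl ?ler_wpM2r// -us ltW.
    case/andP: xu => xu1 xu2; rewrite normrM /k addrAC subrr add0r normfV.
    apply: ler_pM => //; last first.
      by rewrite lef_pV2// posrE ?(lt_le_trans _ xu1) -?us.
    apply: fm; apply/andP; split; last first.
      rewrite (le_trans (ler_normD _ _))// (le_trans (lerD (ltW zR) xu2))//.
      by rewrite /s [leLHS](_ : _ = 7 * R)//; ring.
    have := ler_normB (z + x * u) z; rewrite addrAC subrr add0r => tri.
    rewrite -(lerD2r R) (le_trans _ (le_trans tri (lerD (lexx _) (ltW zR))))//.
    by rewrite (le_trans _ xu1)// /s [leLHS](_ : _ = 3 * R)//; ring.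
  have mE : m = m / s * `|u| by rewrite us divfK.
  split; rewrite [leRHS]mE.
    have <- : `|'i * u| = `|u| by rewrite normrM normCi mul1r.
    apply: midpoint_sum_le => t /side_norm/andP[n1 _].
    by rewrite -addrA (_ : u + _ = (1 + 'i * t) * u) ?key//; ring.
  apply: midpoint_sum_le => t /side_norm/andP[_ n2].
  by rewrite -addrA (_ : 'i * u + _ = (t + 'i * 1) * u) ?key//; ring.
have kIm n u : u != 0 ->
    1 <= 'Im (midpoint_sum n k (z + u) ('i * u) - midpoint_sum n k (z +
      'i * u) u).
  move=> u0; rewrite raddfD/= [leLHS](splitr 1) mul1r lerD//.
    by apply: midpoint_sum_Im_ge => t /(side_kernel z u0)[].
  rewrite -mulN1r -midpoint_sumZ; apply: midpoint_sum_Im_ge =>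
    t /(side_kernel z u0)[_].
  by rewrite mulN1r.
rewrite -(ler_pM2l (ltr0n K 4)) (_ : 4 * (2 * m) = 8 * m); last by ring.
apply/ler_addgt0Pr => e e0.
have [n Fn] := square_sum_small s0 d0 Fpos dF F_le e0.
have outerE : square_sum n F z s = square_sum n (fun y =>
  f y * k y) z s - f z * square_sum n k z s.
  have midE a u : midpoint_sum n F a u = midpoint_sum n (fun y =>
    f y * k y) a u - f z * midpoint_sum n k a u.
    rewrite -mulNr -midpoint_sumZ -midpoint_sumD; apply: eq_midpoint_sum => y;
      rewrite /F; ring.
  by rewrite /square_sum !midE; ring.
have is0 : 'i * s != 0 by rewrite mulf_neq0// neq0Ci.
have fz4 : 4 * `|f z| <= `|f z * square_sum n k z s|.
  rewrite normrM mulrC ler_wpM2l//.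
  apply: (@le_trans _ _ ('Im (square_sum n k z s))).
    have Im4 (a b c d' : K) : 'Im (a + b + c + d') =
      'Im a + 'Im b + 'Im c + 'Im d'.
      by rewrite !raddfD.
    rewrite /square_sum Im4 (_ : 4 = 1 + 1 + 1 + 1 :> K); last by ring.
    by rewrite !lerD// kIm ?oppr_eq0.
  rewrite (le_trans (real_ler_norm (Creal_Im _)))//.
  by rewrite -normrN -ReMil (le_trans (leif_normC_Re_Creal _).1)//
    normrM normCi mul1r.
rewrite (le_trans fz4)// (_ : f z * _ = square_sum n (fun y =>
  f y * k y) z s - square_sum n F z s); last first.
  by rewrite outerE; ring.
rewrite (le_trans (ler_normB _ _))// lerD//.
have n4 (a b c d' : K) : `|a + b + c + d'| <= `|a| + `|b| + `|c| + `|d'|.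
  rewrite (le_trans (ler_normD _ _))// lerD// (le_trans (ler_normD _ _))//
    lerD//.
  exact: ler_normD.
rewrite /square_sum (le_trans (n4 _ _ _ _))// (_ : 8 * m =
  (m + m) + (m + m) + (m + m) + (m + m)); last by ring.
have sn : `|s| = s by rewrite ger0_norm// mulr_ge0// ltW.
have sd u : `|u| = s -> `|midpoint_sum n (fun y => f y * k y) (z + u) ('i * u) -
    midpoint_sum n (fun y => f y * k y) (z + 'i * u) u| <= m + m.
  by move=> us; have [h1 h2] := side_le n u us;
    rewrite (le_trans (ler_normB _ _))// lerD.
by rewrite !lerD// sd// ?normrN// normrM normCi mul1r.
Qed.
End WeakMaximum.

(** * The maximum principle and Newton interpolation *)

Section Interpolation.
Context (K : numClosedFieldType).
Hypotheses (Kc : interval_complete K) (Ka : archimedean_norm K).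
Implicit Types (f g : K -> K) (z w y : K).

Lemma le_of_expn_le (a m C : K) : 0 <= a -> 0 <= m ->
  (forall p, a ^+ p <= C * m ^+ p) -> a <= m.
Proof.
move=> a0 m0 le_p; have [//|am] := real_leP (ger0_real a0) (ger0_real m0).
have C0 : 0 <= C by have := le_p 0%N; rewrite !expr0 mulr1; exact: le_trans.
have [m00|/eqP m00] := m =P 0.
  by move: am (le_p 1%N); rewrite !expr1 m00 mulr0 => /lt_geF ->.
have {m0 m00}m0 : 0 < m by rewrite lt_def m00.
pose x := a / m - 1; have x0 : 0 < x by rewrite subr_gt0 ltr_pdivlMr// mul1r.
have bernoulli p : p%:R * x <= (a / m) ^+ p.
  elim: p => [|p ih]; first by rewrite mul0r expr0 ler01.
  have -> : a / m = 1 + x by rewrite /x addrCA subrr addr0.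
  rewrite exprS mulrDl mul1r -natr1 mulrDl mul1r lerD//.
    by rewrite (_ : 1 + x = a / m)// /x addrCA subrr addr0.
  by rewrite (ler_peMr (ltW x0))// exprn_ege1// lerDl ltW.
have [p pC] := Ka (divr_ge0 C0 (ltW x0)).
have : p%:R * x <= C.
  by rewrite (le_trans (bernoulli p))// expr_div_n ler_pdivrMr ?exprn_gt0.
by move: pC; rewrite ltr_pdivrMr// => /lt_geF ->.
Qed.

(** The weak maximum principle for f ^ p times the product of the (y - s) ^ 2, a
    function without singularities, bounds |f z| ^ p by a constant times m ^ p;
    the constant disappears as p grows. *)
Lemma maximum_off_finite f (S : seq K) (R m B : K) z : 0 < R ->
  (forall s, s \in S -> `|s| < R) ->
  (forall y, y \notin S -> cdiff f y) ->
  (forall y, y \notin S -> `|y| <= 7 * R -> `|f y| <= B) ->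
  (forall y, R <= `|y| <= 7 * R -> `|f y| <= m) ->
  z \notin S -> `|z| <= 7 * R -> `|f z| <= m.
Proof.
move=> R0 SR df fB fm zS z7.
have [Rz|zR] := real_leP (gtr0_real R0) (normr_real z).
  by apply: fm; rewrite Rz z7.
have R2 : R <= 2 * R by rewrite ler_peMl ?ltW// ltr1n.
have R7 : R <= 7 * R by rewrite ler_peMl ?ltW// ltr1n.
have m0 : 0 <= m by rewrite (le_trans _ (fm R _))// gtr0_norm// lexx R7.
have B0 : 0 <= B by rewrite (le_trans _ (fB z zS z7)).
pose D := (8 * R) ^+ 2; have D0 : 0 <= D by rewrite exprn_ge0// mulr_ge0// ltW.
pose P (S : seq K) y := \prod_(s <- S) (y - s) ^+ 2.
have P_le (S' : seq K) y : {subset S' <= S} -> `|y| <= 7 * R ->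
    `|P S' y| <= D ^+ size S'.
  move=> S'S y7; elim: S' S'S => [|s S' ih] S'S; rewrite /P.
    by rewrite big_nil normr1 expr0.
  rewrite big_cons normrM /= [in leRHS]exprS normrX ler_pM//; last first.
    by apply: ih => t tS'; rewrite S'S// inE tS' orbT.
  rewrite lerXn2r ?nnegrE// ?mulr_ge0 ?(ltW R0)//.
  rewrite (le_trans (ler_normB _ _))// (_ : 8 * R = 7 * R + R); last by ring.
  by rewrite lerD// ltW// SR// S'S// mem_head.
apply: (@le_of_expn_le _ _ (2 * D ^+ size S / `|P S z|)) => // p.
pose h y := f y ^+ p * P S y.
have hS s : s \in S -> h s = 0.
  move=> sS; rewrite /h /P (big_rem _ sS)/= subrr.
  by rewrite expr0n mul0r mulr0.
have h_le : `|h z| <= 2 * (m ^+ p * D ^+ size S).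
  apply: (@weak_maximum _ Kc Ka h R) => // y.
    have [yS|yS] := boolP (y \in S); last first.
      apply: cdiffM; first exact/cdiffX/df.
      by apply: cdiff_prod => s; apply/cdiffX/cdiff_sub.
    apply: (@cdiff_removable _ _ (B ^+ p * D ^+ size (rem y S)) (6 * R)).
    - by rewrite mulr_ge0// exprn_ge0.
    - by rewrite mulr_gt0.
    - exact: hS.
    move=> w wy; have w7 : `|w| <= 7 * R.
      rewrite -(subrK y w) (le_trans (ler_normD _ _))//.
      by rewrite (_ : 7 * R = 6 * R + R) ?lerD ?ltW ?SR//; ring.
    have [wS|wS] := boolP (w \in S).
      rewrite hS// normr0 mulr_ge0 ?exprn_ge0// mulr_ge0// exprn_ge0//.
    rewrite /h /P (big_rem _ yS)/= normrM normrX.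
    rewrite -[leRHS]mulrA ler_pM ?exprn_ge0//.
      by rewrite lerXn2r ?nnegrE ?fB.
    rewrite normrM normrX mulrC ler_wpM2r ?exprn_ge0//.
    by apply: P_le => // t /mem_rem.
  move=> /andP[y2 y7]; rewrite /h normrM normrX ler_pM ?exprn_ge0//.
    by rewrite lerXn2r ?nnegrE// fm// y7 (le_trans R2).
  exact: P_le.
have P0 : 0 < `|P S z|.
  rewrite normr_gt0 prodf_seq_neq0; apply/allP => s sS /=.
  by rewrite expf_neq0// subr_eq0; apply: contraNneq zS => ->.
rewrite mulrAC ler_pdivlMr// -normrX -normrM (le_trans h_le)//.
by rewrite mulrAC mulrA.
Qed.

(** A linear operator on functions which uses only the values at finitely many
    nodes: a rule lists the nodes with the polynomials that multiply the
    values. *)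
Definition apply_rule (r : seq (K * {poly K})) g w :=
  \sum_(i <- r) i.2.[w] * g i.1.

(** Newton interpolation. The divided difference g1 of g at a node x is bounded
    on the shell R <= |y| <= 7 * R by 2 * B / (R - 1), hence everywhere by the
    maximum principle; one node costs that factor and contributes the factor |w
    - x|. *)
Lemma newton_remainder (ws : seq K) :
  uniq ws -> (forall x, x \in ws -> `|x| <= 1) ->
  exists r : seq (K * {poly K}), forall (R B : K) g (S : seq K), 1 < R ->
    (forall s, s \in S -> `|s| <= 1 /\ s \notin ws) ->
    (forall y, y \notin S -> cdiff g y) ->
    (forall y, y \notin S -> `|y| <= 7 * R -> `|g y| <= B) ->
    forall w, w \notin S -> `|w| <= 7 * R ->
      `|g w - apply_rule r g w| <= B * \prod_(x <- ws) (2 * `|w - x| / (R - 1)).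
Proof.
elim: ws => [|x ws ih] /=.
  by move=> _ _; exists [::] => R B g S R1 _ _ gB w wS w7;
    rewrite /apply_rule !big_nil mulr1 subr0 gB.
move=> /andP[xws uws] ws1; have [|r rP] := ih uws.
  by move=> y yws; rewrite ws1// inE yws orbT.
pose c (i : K * {poly K}) := (i.1 - x)^-1 *: (('X - x%:P) * i.2).
exists ((x, 1 - \sum_(i <- r) c i) :: [seq (i.1, c i) | i <- r]).
move=> R B g S R1 SP dg gB w wS w7.
pose g1 y := (g y - g x) / (y - x).
have x1 : `|x| <= 1 by rewrite ws1// mem_head.
have R0 : 0 < R by rewrite (lt_trans ltr01).
have R10 : 0 < R - 1 by rewrite subr_gt0.
have R7 : R <= 7 * R by rewrite ler_peMl ?ltW// ltr1n.
have xS : x \notin S by apply/negP => /SP[_]; rewrite mem_head.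
have step : g w - apply_rule ((x, 1 - \sum_(i <- r) c i) :: [seq (i.1,
  c i) | i <- r]) g w =
    (w - x) * (g1 w - apply_rule r g1 w).
  rewrite /apply_rule big_cons big_map/= hornerD hornerN hornerC horner_sum.
  have -> : (w - x) * (g1 w - \sum_(i <- r) i.2.[w] * g1 i.1) =
      g w - g x - \sum_(i <- r) (c i).[w] * (g i.1 - g x).
    rewrite mulrBr mulr_sumr; congr (_ - _).
      have [->|wx] := eqVneq w x; first by rewrite !subrr mul0r.
      by rewrite mulrC divfK// subr_eq0.
    apply: eq_bigr => i _; rewrite /c hornerZ hornerM hornerXsubC /g1; ring.
  have -> : \sum_(i <- r) (c i).[w] * (g i.1 - g x) =
      \sum_(i <- r) (c i).[w] * g i.1 - (\sum_(i <- r) (c i).[w]) * g x.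
    by rewrite mulr_suml -sumrB; apply: eq_bigr => i _; rewrite mulrBr.
  by ring.
rewrite step normrM big_cons.
have B0 : 0 <= B by rewrite (le_trans _ (gB w wS w7)).
have B10 : 0 <= 2 * B / (R - 1) by rewrite divr_ge0 ?mulr_ge0// ltW.
have [->|wx] := eqVneq w x; first by rewrite subrr normr0 mulr0 !mul0r mulr0.
have shell y : R <= `|y| -> R - 1 <= `|y - x|.
  move=> Ry; rewrite lerBlDr (le_trans Ry)// -{1}(subrK x y).
  by rewrite (le_trans (ler_normD _ _))// lerD2l.
have g1_shell y : R <= `|y| <= 7 * R -> `|g1 y| <= 2 * B / (R - 1).
  move=> /andP[Ry y7]; rewrite /g1 normrM normfV ler_pM ?invr_ge0//; last first.
    by rewrite lef_pV2 ?shell// posrE (lt_le_trans _ (shell _ Ry)).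
  rewrite (le_trans (ler_normB _ _))// mulr2n mulrDl mul1r lerD ?gB//.
    by apply/negP => /SP[]; rewrite (lt_geF (lt_le_trans R1 Ry)).
  by rewrite (le_trans x1)// (le_trans (ltW R1)).
have xS' s : s \in x :: S -> `|s| <= 1 /\ s \notin ws.
  by rewrite inE => /predU1P[->//|/SP[s1]]; rewrite inE negb_or => /andP[_ ?].
have dg1 y : y \notin x :: S -> cdiff g1 y.
  rewrite inE negb_or => /andP[yx yS]; apply: cdiffM.
    by apply: cdiffD; [exact: dg|exact: cdiff_cst].
  by apply: cdiffV; [exact: cdiff_sub|rewrite subr_eq0].
(* a crude bound near x, only used to make the singularity at x removable *)
have [B' g1B'] : exists B', forall y, y \notin x :: S -> `|y| <= 7 * R ->
  `|g1 y| <= B'.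
  have [q qc gq] := dg x xS; have [d d0 dq] :=
    (continuous_epsP _ _).1 qc 1 ltr01.
  exists (`|q x| + 1 + 2 * B / d) => y.
  rewrite inE negb_or => /andP[yx yS] y7; rewrite /g1.
  have [dy|yd] := real_leP (gtr0_real d0) (normr_real (y - x)).
    rewrite ler_wpDl ?addr_ge0// normrM normfV ler_pM ?invr_ge0//.
      rewrite (le_trans (ler_normB _ _))// mulr2n mulrDl mul1r lerD ?gB//.
      by rewrite (le_trans x1)// (le_trans (ltW R1)).
    by rewrite lef_pV2// posrE (lt_le_trans d0).
  rewrite ler_wpDr ?divr_ge0 ?mulr_ge0 ?(ltW d0)//.
  rewrite (gq y) addrAC subrr add0r mulfK ?subr_eq0//.
  rewrite -(subrK (q x) (q y)) addrC (le_trans (ler_normD _ _))//.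
  by rewrite lerD2l ltW// dq.
have g1B y : y \notin x :: S -> `|y| <= 7 * R -> `|g1 y| <= 2 * B / (R - 1).
  apply: (maximum_off_finite R0 _ dg1 g1B' g1_shell) => s /xS'[s1 _].
  exact: le_lt_trans R1.
have := rP _ _ g1 (x :: S) R1 xS' dg1 g1B w.
rewrite inE negb_or wx wS => /(_ isT w7) le1.
rewrite (le_trans (ler_wpM2l _ le1))// (_ : `|w - x| * _ =
  B * (2 * `|w - x| / (R - 1) * \prod_(x <- ws) (2 * `|w - x| / (R - 1))))//.
by ring.
Qed.

(** Every entire function is approximated on a disc by a fixed rule, with an
    error controlled by its supremum on a larger disc. With nodes in the unit
    disc and R large each node contributes at most 1/2 to the remainder. *)
Lemma entire_interpolation (r : K) : 0 <= r -> exists2 R : K, 0 < R &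
  forall e : K, 0 < e -> exists rule : seq (K * {poly K}), forall g (B : K),
    (forall y, cdiff g y) -> (forall y, `|y| <= R -> `|g y| <= B) ->
    forall w, `|w| <= r -> `|g w - apply_rule rule g w| <= e * B.
Proof.
move=> r0; pose R0 : K := 1 + 4 * (r + 1).
have r1 : 0 < r + 1 by rewrite ltr_wpDl.
have R01 : 1 < R0 by rewrite ltrDl mulr_gt0.
have rR : r <= 7 * R0 by rewrite /R0 -subr_ge0 (_ : _ - r =
  27 * r + 35) ?addr_ge0 ?mulr_ge0//; ring.
exists (7 * R0) => [|e e0]; first by rewrite mulr_gt0// (lt_trans ltr01).
have [M Me] := archimedean_exp Ka ler01 e0.
(* any M distinct points of the unit disc would do *)
pose ws : seq K := [seq (i.+1%:R)^-1 | i <- iota 0 M].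
have uws : uniq ws.
  rewrite map_inj_uniq ?iota_uniq// => i j /invr_inj/eqP.
  by rewrite eqr_nat => /eqP[].
have ws1 x : x \in ws -> `|x| <= 1.
  by move=> /mapP[i _ ->]; rewrite normfV normr_nat invf_le1 ?ler1n.
have [rule ruleP] := newton_remainder uws ws1.
exists rule => g B dg gB w wr.
have B0 : 0 <= B by rewrite (le_trans _ (gB w _))// (le_trans wr).
have := ruleP R0 B g [::] R01 (fun s => ltac:(by [])) (fun y _ => dg y)
  (fun y _ => gB y) w isT (le_trans wr rR).
move=> /le_trans; apply; rewrite mulrC ler_wpM2r//.
rewrite (le_trans _ (ltW Me))// div1r -exprVn.
have -> : 2^-1 ^+ M = \prod_(x <- ws) 2^-1 :> K.
  by rewrite big_const_seq count_predT size_map size_iota iter_mulr_1.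
rewrite big_seq [leRHS]big_seq; apply: ler_prod => x /ws1 x1.
have d0 : 0 < R0 - 1 by rewrite subr_gt0.
rewrite divr_ge0 ?mulr_ge0 ?(ltW d0)//= ler_pdivrMr//.
rewrite (_ : 2^-1 * (R0 - 1) = 2 * (r + 1)); last by rewrite /R0; field.
by rewrite ler_pM2l// (le_trans (ler_normB _ _))// lerD.
Qed.
End Interpolation.

(** * Initial segments of the colexicographic order *)

Section PolynomialBounds.
Context (K : numClosedFieldType).
Implicit Types (B r : K).

Lemma prim_root_exists n : (0 < n)%N -> exists w : K, n.-primitive_root w.
Proof.
move=> n0; pose p : {poly K} := 'X^n - 1; have [r Dp] :=
  closed_field_poly_normal p.
rewrite (monicP _) ?monicXnsubC// scale1r in Dp.
have rn1 : all n.-unity_root r by apply/allP => z; rewrite -root_prod_XsubC -Dp.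
have sz_r : (n < (size r).+1)%N.
  by rewrite -(size_prod_XsubC r id) -Dp size_XnsubC.
have [|z] := hasP (has_prim_root n0 rn1 _ sz_r); last by exists z.
by rewrite -separable_prod_XsubC -Dp separable_Xn_sub_1// pnatr_eq0 -lt0n.
Qed.

(** Cauchy's estimate: average over the roots of unity of an order exceeding the
    degree. *)
Lemma coef_bound (Q : {poly K}) r B t : 0 <= r ->
  (forall z, `|z| <= r -> `|Q.[z]| <= B) -> `|Q`_t| * r ^+ t <= B.
Proof.
move=> r0 QB; pose M := (size Q + t).+1.
have [w] := prim_root_exists (ltn0Sn (size Q + t)); rewrite -/M => wM.
have w1 : `|w| = 1.
  by apply/eqP; rewrite -(@pexpr_eq1 _ _ M)//
    -normrX (prim_expr_order wM) normr1 eqxx.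
have w0 : w != 0 by rewrite -normr_gt0 w1.
have Qw k : (k < M)%N -> \sum_(s < M) (w ^+ k / w ^+ t) ^+ s =
  if k == t then M%:R else 0.
  move=> kM; case: eqVneq => [->|kt].
    rewrite divff ?expf_neq0//; under eq_bigr do rewrite expr1n.
    by rewrite sumr_const card_ord.
  apply/eqP; have : (w ^+ k / w ^+ t) ^+ M - 1 = 0.
    by rewrite expr_div_n -!exprM ![(_ * M)%N]mulnC !exprM (prim_expr_order
      wM) !expr1n divr1 subrr.
  rewrite subrX1 => /eqP; rewrite mulf_eq0 subr_eq0 => /orP[|//].
  rewrite -[1](divff (expf_neq0 t w0)) (inj_eq (mulIf (invr_neq0 (expf_neq0 t
    w0)))).
  rewrite (eq_prim_root_expr wM) !modn_small// ?(negPf kt)//.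
  by rewrite /M ltnS leq_addl.
have tM : (t < M)%N by rewrite /M ltnS leq_addl.
have avg : \sum_(s < M) Q.[r * w ^+ s] / (w ^+ t) ^+ s = M%:R * (Q`_t * r ^+ t).
  transitivity (\sum_(k < M) Q`_k * r ^+ k * \sum_(s <
    M) (w ^+ k / w ^+ t) ^+ s).
    under [RHS]eq_bigr do rewrite mulr_sumr.
    rewrite exchange_big/=; apply: eq_bigr => s _.
    rewrite (@horner_coef_wide _ M); last by rewrite /M leqW// leq_addr.
    rewrite mulr_suml; apply: eq_bigr => k _.
    by rewrite exprMn expr_div_n -!exprM [(s * k)%N]mulnC !mulrA.
  rewrite (bigD1 (Ordinal tM))//= Qw// eqxx big1 ?addr0; first by rewrite mulrC.
  move=> k kt; rewrite Qw// ifN ?mulr0//.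
have M0 : 0 < M%:R :> K by rewrite ltr0n.
rewrite -(ler_pM2l M0) -{1}(normr_nat K M) -(ger0_norm (exprn_ge0 t r0))
  -!normrM -avg.
rewrite (le_trans (ler_norm_sum _ _ _))//.
have -> : M%:R * B = \sum_(s < M) B by rewrite sumr_const card_ord mulr_natl.
apply: ler_sum => s _; rewrite normrM normfV !normrX w1 !expr1n divr1 QB//.
by rewrite normrM normrX w1 expr1n mulr1 ger0_norm.
Qed.

Context (T : eqType).
Implicit Types (s : seq T) (c : T -> K) (l : nat -> K).

Lemma graded_bound s c (wt : T -> nat) r B t : 0 <= r ->
  (forall z, `|z| <= r -> `|\sum_(a <- s) c a * z ^+ wt a| <= B) ->
  `|\sum_(a <- s | wt a == t) c a| * r ^+ t <= B.
Proof.
move=> r0 sB; pose Q := \sum_(a <- s) c a *: 'X^(wt a).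
have -> : \sum_(a <- s | wt a == t) c a = Q`_t.
  rewrite coef_sum big_mkcond; apply: eq_bigr => a _.
  by rewrite coefZ coefXn eq_sym; case: eqP => _; rewrite ?mulr1 ?mulr0.
apply: coef_bound => // z zr; rewrite horner_sum.
by under eq_bigr do rewrite hornerZ hornerXn; exact: sB.
Qed.

Context (ex : T -> nat -> nat).

Definition eval_monomial m l a : K := \prod_(j < m) l j ^+ ex a j.

(** The square order within one degree is the colexicographic order: comparing
    the lengths first is the same as comparing the last exponents that
    differ. *)
Definition colex_le a b := (forall j, ex a j = ex b j) \/
  exists2 j, (ex a j < ex b j)%N & forall i, (j < i)%N -> ex a i = ex b i.

Lemma eval_monomial1 m a : eval_monomial m (fun=> 1) a = 1.
Proof. by rewrite /eval_monomial big1// => j _; rewrite expr1n. Qed.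

Lemma sum_eval_monomial1 m s c (P : pred T) :
  \sum_(a <- s | P a) c a * eval_monomial m (fun=> 1) a =
    \sum_(a <- s | P a) c a.
Proof. by apply: eq_bigr => a _; rewrite eval_monomial1 mulr1. Qed.

(** Extracting the terms in which the variable k has exponent t is a Cauchy
    projection in that variable, so it does not increase the supremum over the
    polydisc. *)
Lemma coordinate_bound m s c B k t : (k < m)%N ->
  (forall l, (forall j, `|l j| <= 1) ->
    `|\sum_(a <- s) c a * eval_monomial m l a| <= B) ->
  forall l, (forall j, `|l j| <= 1) ->
    `|\sum_(a <- s | ex a k == t) c a * eval_monomial m l a| <= B.
Proof.
move=> km sB l l1.
pose c' a := c a * \prod_(j < m | j != Ordinal km) l j ^+ ex a j.
have monE (l' : nat -> K) a : (forall j, j != k -> l' j = l j) ->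
    c a * eval_monomial m l' a = c' a * l' k ^+ ex a k.
  move=> ll'; rewrite /eval_monomial (bigD1 (Ordinal km))//= /c' mulrAC
    -mulrA; congr (_ * (_ * _)).
  by apply: eq_bigr => j jk; rewrite ll'.
have -> : \sum_(a <- s | ex a k == t) c a * eval_monomial m l a =
    (\sum_(a <- s | ex a k == t) c' a) * l k ^+ t.
  by rewrite mulr_suml; apply: eq_bigr => a /eqP <-; exact: monE.
have := @graded_bound s c' (ex^~ k) 1 B t ler01; rewrite expr1n mulr1 => gB.
rewrite normrM normrX (@le_trans _ _ `|\sum_(a <- s | ex a k == t) c' a|)//.
  by rewrite ler_piMr// exprn_ile1.
apply: gB => z z1; pose l' j := if j == k then z else l j.
rewrite (eq_bigr (fun a => c a * eval_monomial m l' a)) => [|a _]; last first.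
  by rewrite monE /l' ?eqxx// => j /negPf ->.
by apply: sB => j; rewrite /l'; case: eqP.
Qed.

(** Let t be the largest exponent of the last variable occurring in the initial
    segment. All terms with a smaller exponent belong to it, which costs t
    Cauchy projections; the terms with exponent t form an initial segment in one
    variable less and of degree n - t. The total cost t + (n - t + 1) is n +
    1. *)
Lemma initial_bound m k n s c B (I : pred T) : (k <= m)%N ->
  (forall a b, a \in s -> b \in s -> forall j, (k <= j)%N -> ex a j = ex b j) ->
  (forall a, a \in s -> (\sum_(j < k) ex a j)%N = n) ->
  (forall a b, a \in s -> b \in s -> colex_le a b -> I b -> I a) ->
  (forall l, (forall j, `|l j| <= 1) ->
    `|\sum_(a <- s) c a * eval_monomial m l a| <= B) ->
  `|\sum_(a <- s | I a) c a| <= n.+1%:R * B.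
Proof.
have one1 (j : nat) : `|1 : K| <= 1 by rewrite normr1.
elim: k n s => [|k ih] n s km same deg init sB.
  have B0 : 0 <= B by rewrite (le_trans _ (sB (fun=> 1) one1)).
  rewrite -big_filter; have [/hasP[b bs Ib]|noI] := boolP (has I s); last first.
    rewrite (_ : [seq a <- s | I a] = [::]) ?big_nil ?normr0 ?mulr_ge0//.
    by apply/eqP; rewrite -(negbK (_ == _)) -has_filter.
  have -> : [seq a <- s | I a] = s.
    apply/all_filterP/allP => a sa; apply: (init _ b) => //; left => j.
    exact: same.
  have := sB (fun=> 1) one1; rewrite sum_eval_monomial1.
  by move/le_trans; apply; rewrite ler_peMl// ler1n.
have B0 : 0 <= B by rewrite (le_trans _ (sB (fun=> 1) one1)).
have [/hasP[b bs Ib]|noI] := boolP (has I s); last first.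
  rewrite -big_filter (_ : [seq a <- s | I a] =
    [::]) ?big_nil ?normr0 ?mulr_ge0//.
  by apply/eqP; rewrite -(negbK (_ == _)) -has_filter.
pose P t := has (fun b => I b && (ex b k == t)) s.
have exP : exists t, P t by exists (ex b k); apply/hasP; exists b;
  rewrite ?Ib ?eqxx.
have ex_n a : a \in s -> (ex a k <= n)%N.
  by move=> /deg <-; rewrite big_ord_recr/= leq_addl.
have Pn t : P t -> (t <= n)%N by move=> /hasP[a sa /andP[_ /eqP <-]];
  exact: ex_n.
case: (ex_maxnP exP Pn) => t /hasP[{bs Ib}b bs /andP[Ib /eqP bt]] tmax.
have tn := Pn t; rewrite {}/P in exP Pn tmax tn.
have {}tn : (t <= n)%N by apply: tn; apply/hasP; exists b;
  rewrite ?Ib ?bt ?eqxx.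
have Iup a : a \in s -> (t < ex a k)%N -> I a = false.
  move=> sa ta; apply/negP => Ia; have := tmax (ex a k).
  rewrite leqNgt ta => /(_ _)/negP; apply; last by [].
  by apply/hasP; exists a; rewrite ?Ia ?eqxx.
have Idown a : a \in s -> (ex a k < t)%N -> I a.
  move=> sa ta; apply: (init a b) => //; right; exists k; rewrite ?bt// => i ki.
  exact: same.
have -> : \sum_(a <- s | I a) c a = \sum_(i <
  t) \sum_(a <- s | ex a k == i) c a +
    \sum_(a <- [seq a <- s | ex a k == t] | I a) c a.
  rewrite big_filter_cond (bigID (fun a => ex a k == t))/= addrC;
    congr (_ + _); last first.
    by apply: eq_bigl => a; rewrite andbC.
  rewrite (exchange_big_dep xpredT)//= big_seq_cond [RHS]big_seq.
  rewrite big_mkcond [RHS]big_mkcond; apply: eq_bigr => a _.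
  case: (boolP (a \in s)) => //= sa; case: (ltngtP (ex a k) t) => [lt|gt|->].
  - rewrite Idown// (big_pred1 (Ordinal lt))// => i.
  - by rewrite Iup// big1// => i /eqP ai; move: gt (ltn_ord i); rewrite ai; lia.
  - by rewrite /= andbF big1// => i /eqP ti; have := ltn_ord i;
    rewrite -ti ltnn.
rewrite (_ : n.+1%:R * B = t%:R * B + (n - t).+1%:R * B); last first.
  by rewrite -mulrDl -natrD addnS subnKC.
rewrite (le_trans (ler_normD _ _))// lerD//.
  rewrite (le_trans (ler_norm_sum _ _ _))//.
  rewrite (_ : t%:R * B = \sum_(i < t) B);
    last by rewrite sumr_const card_ord mulr_natl.
  apply: ler_sum => i _; have :=
    @coordinate_bound m s c B k i km sB (fun=> 1) one1.
  by rewrite sum_eval_monomial1.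
apply: ih => [|a a'|a|a a'|l l1].
- exact: ltnW.
- rewrite !mem_filter => /andP[/eqP at_ sa] /andP[/eqP a't sa'] j.
  rewrite leq_eqVlt => /predU1P[<-|kj]; first by rewrite at_.
  exact: same.
- rewrite mem_filter => /andP[/eqP at_ /deg]; rewrite big_ord_recr/= at_ => <-.
  by rewrite addnK.
- by rewrite !mem_filter => /andP[_ sa] /andP[_ sa']; exact: init.
- by rewrite big_filter; exact: coordinate_bound.
Qed.

Lemma sum_degree_weights D : \sum_(d < D) d.+1%:R / 2 ^+ d <= 4 :> K.
Proof.
suff -> : \sum_(d < D) d.+1%:R / 2 ^+ d = 4 - (2 * D + 4)%:R / 2 ^+ D :> K.
  by rewrite lerBlDr lerDl divr_ge0.
elim: D => [|D ih]; first by rewrite big_ord0 expr0 divr1 muln0 add0n subrr.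
rewrite big_ord_recr/= ih exprS mulnS !(natrD, natrM).
have -> : D.+1%:R = D%:R + 1 :> K by rewrite natr1.
field.
by rewrite expf_neq0.
Qed.

(** On the polydisc of radius 2 the terms of degree d gain a factor 2 ^ d, which
    compensates the cost d + 1 of an initial segment: the weights (d + 1) / 2 ^
    d have sum 4. *)
Lemma compatible_partial_sum_bound m s c B (I : pred T) :
  let deg a := (\sum_(j < m) ex a j)%N in
  (forall a j, a \in s -> (m <= j)%N -> ex a j = 0%N) ->
  (forall a b, a \in s -> b \in s -> deg a = deg b -> colex_le a b ->
    I b -> I a) ->
  (forall l, (forall j, `|l j| <= 2) ->
    `|\sum_(a <- s) c a * eval_monomial m l a| <= B) ->
  `|\sum_(a <- s | I a) c a| <= 4 * B.
Proof.
move=> deg exm init sB; pose D := (\max_(a <- s) deg a).+1.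
have B0 : 0 <= B by rewrite (le_trans _ (sB (fun=> 0) _))// normr0.
have degD a : a \in s -> (deg a < D)%N.
  by move=> sa; rewrite ltnS (leq_bigmax_seq (F := deg))//.
have -> : \sum_(a <- s | I a) c a =
    \sum_(d < D) \sum_(a <- [seq a <- s | deg a == d] | I a) c a.
  under [RHS]eq_bigr do rewrite big_filter_cond.
  rewrite (exchange_big_dep xpredT)//= big_seq_cond [RHS]big_seq.
  rewrite big_mkcond [RHS]big_mkcond; apply: eq_bigr => a _.
  case: (boolP (a \in s)) => //= sa; case: ifP => Ia; last first.
    by rewrite big1// => i; rewrite andbF.
  by rewrite (big_pred1 (Ordinal (degD _ sa)))// => i; rewrite andbT.
rewrite (le_trans (ler_norm_sum _ _ _))//.
apply: (@le_trans _ _ (\sum_(d < D) d.+1%:R / 2 ^+ d * B)); last first.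
  by rewrite -mulr_suml ler_wpM2r// sum_degree_weights.
apply: ler_sum => d _; rewrite -mulrA; apply: (@initial_bound m m d) => //.
- by move=> a b; rewrite !mem_filter => /andP[_ sa] /andP[_ sb] j mj;
  rewrite !exm.
- by move=> a; rewrite mem_filter => /andP[/eqP].
- move=> a b; rewrite !mem_filter => /andP[/eqP da sa] /andP[/eqP db sb].
  by apply: init => //; rewrite da.
move=> l l1; rewrite big_filter mulrC ler_pdivlMr ?exprn_gt0//.
apply: graded_bound => // z z2.
rewrite (eq_bigr (fun a => c a * eval_monomial m (fun j => z * l j) a)) =>
  [|a _].
  by apply: sB => j; rewrite normrM -[2]mulr1 ler_pM.
rewrite -mulrA /eval_monomial; congr (_ * _);
  under [RHS]eq_bigr do rewrite exprMn.
by rewrite big_split/= mulrC -expr_sum.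
Qed.

End PolynomialBounds.

(** * Multipliers and solid hulls *)

Section UnconditionalBasis.
Context (K : numClosedFieldType) (X : normedModType K) (e : nat -> X).
Hypotheses (e_basis : schauder_basis e) (e_uncond : unconditional1 e).
Implicit Types (x y : X) (a l : nat -> K) (m j : nat).

Definition bounded1 l := forall j, `|l j| <= 1.

Definition fsum m a : X := \sum_(j < m) a j *: e j.

Lemma expansion_unique a x y : expansion e a x -> expansion e a y -> x = y.
Proof. by move=> ax ay; apply: cvg_unique ax ay; exact: norm_hausdorff. Qed.

Lemma expansion_fsum m a :
  expansion e (fun j => if (j < m)%N then a j else 0) (fsum m a).
Proof.
apply: cvg_near_cst; exists m => // n /= mn.
rewrite /series/= /fsum big_mkord -(big_mkord xpredT (fun j => a j *: e j)).
rewrite -(big_mkord xpredT (fun j => (if (j < m)%N then a j else 0) *: e j)).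
rewrite (big_cat_nat (leq0n m) mn)//= [X in _ + X](_ : _ = 0) ?addr0;
  last first.
  rewrite big_nat_cond big1// => j /andP[/andP[mj _] _].
  by rewrite ltnNge mj scale0r.
rewrite big_nat_cond [RHS]big_nat_cond; apply: eq_bigr =>
  j /andP[/andP[_ jm] _].
by rewrite jm.
Qed.

Lemma coef_fsum m a j : coef e j (fsum m a) = if (j < m)%N then a j else 0.
Proof.
by have /(congr1 (@^~ j))/= <- :=
  schauder_coef_uniq e_basis (@expansion_fsum m a).
Qed.

Lemma coef_inj x y : (forall j, coef e j x = coef e j y) -> x = y.
Proof.
move=> xy; apply: expansion_unique (@schauder_coefP _ _ e x e_basis) _.
rewrite (_ : (fun j => coef e j x) = fun j => coef e j y); last exact/funext.
exact: schauder_coefP.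
Qed.

Lemma coefB j x y : coef e j (x - y) = coef e j x - coef e j y.
Proof.
have := coef_is_linear j e_basis (-1) y x;
  rewrite scaleN1r [- y + x]addrC => ->.
by rewrite /GRing.scale/= mulN1r addrC.
Qed.

Lemma coefZ j (k : K) x : coef e j (k *: x) = k * coef e j x.
Proof.
have lin := coef_is_linear j e_basis.
have c0 : coef e j 0 = 0 by have := coefB j 0 0; rewrite !subrr.
by have := lin k x 0; rewrite !addr0 c0 addr0.
Qed.

(** The diagonal operator multiplying the coefficients by l; it is defined on
    all of X when l is bounded by 1. *)
Definition mult l x : X :=
  xget 0 [set y | expansion e (fun j => l j * coef e j x) y].

Lemma multP l x : bounded1 l ->
  expansion e (fun j => l j * coef e j x) (mult l x) /\ `|mult l x| <= `|x|.
Proof.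
move=> l1; have [y ey yx] := e_uncond (@schauder_coefP _ _ e x e_basis) l1.
have em : expansion e (fun j => l j * coef e j x) (mult l x).
  exact: (@xgetPex _ 0 [set y | expansion e (fun j =>
    l j * coef e j x) y] (ex_intro _ y ey)).
by split=> //; rewrite (expansion_unique em ey).
Qed.

Lemma coef_mult l x j : bounded1 l -> coef e j (mult l x) = l j * coef e j x.
Proof.
move=> l1; have [em _] := multP x l1.
by have /(congr1 (@^~ j))/= <- := schauder_coef_uniq e_basis em.
Qed.

Lemma mult_le l x : bounded1 l -> `|mult l x| <= `|x|.
Proof. by move=> /multP -/(_ x)[]. Qed.

Lemma multB l x y : bounded1 l -> mult l (x - y) = mult l x - mult l y.
Proof.
by move=> l1; apply: coef_inj => j; rewrite coefB !coef_mult// coefB mulrBr.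
Qed.

Lemma mult_fsum m l a : bounded1 l ->
  mult l (fsum m a) = fsum m (fun j => l j * a j).
Proof.
move=> l1; apply: coef_inj => j; rewrite coef_mult// !coef_fsum.
by case: ifP; rewrite ?mulr0.
Qed.

Definition truncate m x := fsum m (fun j => coef e j x).

Lemma truncate_mult m x :
  truncate m x = mult (fun j => if (j < m)%N then 1 else 0) x.
Proof.
apply: coef_inj => j; rewrite coef_mult.
  by rewrite coef_fsum; case: ifP; rewrite ?mul1r ?mul0r.
by move=> i; case: ifP; rewrite ?normr1 ?normr0.
Qed.

Lemma truncate_indicator m : bounded1 (fun j => if (j < m)%N then 1 else 0).
Proof. by move=> i; case: ifP; rewrite ?normr1 ?normr0. Qed.

Lemma truncate_cvg x (eps : K) : 0 < eps -> exists M, forall m, (M <= m)%N ->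
  `|x - truncate m x| < eps.
Proof.
move=> eps0; have /cvgrPdist_lt/(_ eps eps0)[M _ MP] :=
  @schauder_coefP _ _ e x e_basis.
exists M => m /MP /=; rewrite /series/= big_mkord; exact.
Qed.

(** Joint continuity: up to a small tail of x, which l cannot enlarge, only the
    first m entries of l matter. *)
Lemma mult_continuous l x (eps : K) : bounded1 l -> 0 < eps ->
  exists m, exists2 d : K, 0 < d & forall l' y, bounded1 l' -> `|y - x| < d ->
    (forall j, (j < m)%N -> `|l' j - l j| < d) -> `|mult l' y - mult l x| < eps.
Proof.
move=> l1 eps0; have eps6 : 0 < eps / 6 by rewrite divr_gt0.
have [m /(_ m (leqnn m)) mx] := truncate_cvg x eps6.
pose C := \sum_(j < m) `|coef e j x *: e j|.
have C0 : 0 < C + 1 by rewrite ltr_wpDl// sumr_ge0.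
exists m, (eps / 3 / (C + 1)) => [|l' y l'1 yx ll']; first by rewrite !divr_gt0.
set d := eps / 3 / (C + 1) in yx ll' *.
have -> : mult l' y - mult l x = mult l' (y - x) +
    ((mult l' (truncate m x) - mult l (truncate m x)) +
    (mult l' (x - truncate m x) - mult l (x - truncate m x))).
  rewrite !multB// (addrACA (mult l' (truncate m x))) [_ +
    (_ - mult l' (truncate m x))]addrC.
  by rewrite subrK -opprD [mult l (truncate m x) + _]addrC subrK addrA subrK.
have s1 : `|mult l' (y - x)| <= d by rewrite (le_trans (mult_le _ l'1))// ltW.
have s2 : `|mult l' (truncate m x) - mult l (truncate m x)| <= d * C.
  rewrite /truncate !mult_fsum// /fsum -sumrB mulr_sumr.
  rewrite (le_trans (ler_norm_sum _ _ _))//; apply: ler_sum => j _.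
  rewrite -scalerBl -mulrBl -scalerA normrZ ler_wpM2r//.
  by rewrite ltW// ll'.
have s3 : `|mult l' (x - truncate m x) - mult l (x - truncate m x)| <=
  eps / 6 + eps / 6.
  rewrite (le_trans (ler_normB _ _))// lerD// (le_trans (mult_le _ _))// ltW//.
rewrite (le_lt_trans (ler_normD _ _))//.
rewrite (@le_lt_trans _ _ (d + (d * C + (eps / 6 + eps / 6))))//.
  by rewrite lerD// (le_trans (ler_normD _ _))// lerD.
rewrite addrA (_ : d + d * C = eps / 3); last by rewrite /d; field;
  rewrite gt_eqF.
rewrite (_ : eps / 3 + _ = eps * (2 / 3)); last by field.
by rewrite gtr_pMr// ltr_pdivrMr// mul1r ltr_nat.
Qed.

(** The solid hull of A scaled by r. *)
Definition solid_hull (r : K) (A : set X) : set X :=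
  [set z | exists x l, [/\ A x, bounded1 l & z = r *: mult l x]].

(** The image of A times a product of discs, compact by Tychonoff's theorem. *)
Lemma compact_solid_hull (r : K) (A : set X) :
  compact [set z : K^o | `|z| <= 1] ->
  compact A -> compact (solid_hull r A).
Proof.
move=> cD cA.
pose L := [set l : {ptws nat -> K^o} | forall j, `|l j| <= 1].
have cL : compact L.
  exact: (@tychonoff nat (fun=> K^o) (fun=> [set z : K^o | `|z| <= 1])).
pose F (p : X * {ptws nat -> K^o}) := r *: mult p.2 p.1.
have -> : solid_hull r A = F @` (A `*` L).
  apply/seteqP; split=> [z [x [l [Ax l1 ->]]]|z [[x l] [/= Ax l1] <-]].
    by exists (x, l).
  by exists x, l.
apply: continuous_compact; last exact: compact_setX.
apply/subspace_continuousP => -[x l] [/= Ax l1] U /nbhs_ballP[eps /= eps0 epsU].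
have r1 : 0 < `|r| + 1 by rewrite ltr_wpDl.
have [m [d d0 dP]] := mult_continuous x l1 (divr_gt0 eps0 r1).
have nli (i : 'I_m) : nbhs l [set l' : {ptws nat ->
  K^o} | `|l' (val i) - l (val i)| < d].
  apply: (@proj_continuous nat (fun=> K^o) (val i) l [set z : K^o | `|z - l
    (val i)| < d]).
  by apply/nbhs_ballP; exists d => //= z; rewrite -ball_normE/= distrC.
have nl := @filter_forall {ptws nat -> K^o} 'I_m
  (fun i => [set l' : {ptws nat -> K^o} | `|l' (val i) - l (val i)| < d])
  (nbhs l) (nbhs_filter l) nli.
have nx : nbhs x [set y | `|y - x| < d].
  by apply/nbhs_ballP; exists d => //= z; rewrite -ball_normE/= distrC.
suff : within (A `*` L) (nbhs (x, l)) (F @^-1` U) by [].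
exists ([set y | `|y - x| <
  d], [set l' | forall i : 'I_m, `|l' (val i) - l (val i)| < d]) => //=.
move=> [y l'] [/= yx ll'] [/= Ay l'1]; apply: epsU.
rewrite -ball_normE/= /F/= -scalerBr normrZ distrC.
apply: (@le_lt_trans _ _ ((`|r| + 1) * `|mult l' y - mult l x|)).
  by rewrite ler_wpM2r// lerDl.
rewrite mulrC -ltr_pdivlMr//; apply: dP => // j jm.
exact: (ll' (Ordinal jm)).
Qed.

End UnconditionalBasis.

(** * A criterion for Schauder bases of entire functions *)

Section BasisCriterion.
Context (K : numClosedFieldType) (X : normedModType K) (b : nat -> entire X).
Hypotheses (Kc : interval_complete K) (Ka : archimedean_norm K).
Implicit Types (f g : entire X) (A : set X) (a c : nat -> K) (n N D : nat).

Definition partial_sum a N (x : X) : K := \sum_(n < N) a n * b n x.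

Hypothesis b_neq0 : forall n, exists x, b n x != 0.
Hypothesis b_grunblum : forall A, compact A -> exists2 A', compact A' &
  exists2 C : K, 0 < C & forall a N D (B : K), (N <= D)%N ->
    (forall x, A' x -> `|partial_sum a D x| <= B) ->
    forall x, A x -> `|partial_sum a N x| <= C * B.
Hypothesis b_dense : forall f A (eps : K), compact A -> 0 < eps ->
  exists a N, forall x, A x -> `|f x - partial_sum a N x| <= eps.

Lemma partial_sumB a c N x :
  partial_sum (fun n => a n - c n) N x = partial_sum a N x - partial_sum c N x.
Proof. by rewrite /partial_sum -sumrB; apply: eq_bigr => n _;
  rewrite mulrBl. Qed.

Lemma seriesE a N x : series (fun j => a j *: b j) N x = partial_sum a N x.
Proof.
rewrite /series/= /partial_sum big_mkord.
by elim/big_ind2: _ => [//|f y g z <- <- //|//].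
Qed.

Lemma expansion_entireP a f : expansion b a f <->
  forall A (eps : K), compact A -> 0 < eps -> exists M, forall N, (M <= N)%N ->
    forall x, A x -> `|f x - partial_sum a N x| < eps.
Proof.
split=> [af A eps cA eps0|af U /nbhs_entireP[A [eps [cA eps0 epsU]]]].
  have : nbhs f [set g : entire X | forall x, A x -> `|f x - g x| < eps].
    by apply/nbhs_entireP; exists A, eps; split.
  by move=> /af[M _ MP]; exists M => N /MP /= + x Ax => /(_ x Ax);
    rewrite seriesE.
have [M MP] := af A eps cA eps0.
by exists M => // N /= MN; apply: epsU => x Ax /=; rewrite seriesE MP.
Qed.

Lemma b_dense_long f A (eps : K) m : compact A -> 0 < eps ->
  exists a N, [/\ (m <= N)%N, forall n, (N <= n)%N -> a n = 0 &
    forall x, A x -> `|f x - partial_sum a N x| <= eps].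
Proof.
move=> cA eps0; have [a [N aN]] := b_dense f cA eps0.
exists (fun n => if (n < N)%N then a n else 0), (m + N)%N; split=> [|n|x Ax].
- exact: leq_addr.
- by move=> mn; rewrite ltnNge (leq_trans (leq_addl m N) mn).
rewrite (_ : partial_sum _ _ x = partial_sum a N x) ?aN//.
rewrite /partial_sum (big_ord_widen (m + N)%N (fun n =>
  a n * b n x)) ?leq_addl//.
by rewrite [RHS]big_mkcond; apply: eq_bigr => n _; case: ifP; rewrite ?mul0r.
Qed.

Lemma partial_sum_tail a N D x :
  (forall n, (N <= n)%N -> a n = 0) -> (N <= D)%N ->
  partial_sum a D x = partial_sum a N x.
Proof.
move=> a0 ND; rewrite /partial_sum [RHS](big_ord_widen D (fun n =>
  a n * b n x))//.
rewrite [RHS]big_mkcond; apply: eq_bigr => n _; case: ltnP => // /a0 ->.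
by rewrite mul0r.
Qed.

(** The term of index n is the difference of two consecutive partial sums;
    evaluate it at a point where b n does not vanish. *)
Lemma coef_estimate n : exists2 A, compact A & exists2 C : K, 0 < C &
  forall a D (B : K), (n < D)%N ->
    (forall x, A x -> `|partial_sum a D x| <= B) -> `|a n| <= C * B.
Proof.
have [x bx] := b_neq0 n.
have [A cA [C C0 CP]] := b_grunblum (@compact_set1 X x).
have bx0 : 0 < `|b n x| by rewrite normr_gt0.
exists A => //; exists (2 * C / `|b n x|); first by rewrite divr_gt0 ?mulr_gt0.
move=> a D B nD aB; rewrite mulrAC ler_pdivlMr// -normrM.
have -> : a n * b n x = partial_sum a n.+1 x - partial_sum a n x.
  by rewrite /partial_sum big_ord_recr/= [_ + a n * _]addrC addrK.
rewrite (le_trans (ler_normB _ _))// -mulrA mulr2n mulrDl mul1r.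
by rewrite lerD// (CP a _ D)// ltnW.
Qed.

Lemma expansion_coef_unique f a c : expansion b a f -> expansion b c f -> a = c.
Proof.
move=> /expansion_entireP fa /expansion_entireP fc; apply/funext => n.
have [A cA [C C0 CP]] := coef_estimate n.
apply/eqP; rewrite -subr_eq0 -normr_le0; apply/ler_addgt0Pr => eps eps0.
have e0 : 0 < eps / C / 2 by rewrite !divr_gt0.
have [M1 aM] := fa A _ cA e0; have [M2 cM] := fc A _ cA e0.
pose D := (M1 + M2 + n.+1)%N.
rewrite add0r (le_trans (CP (fun n => a n - c n) D (eps / C) _ _))//.
- by rewrite /D; lia.
- move=> x Ax; rewrite partial_sumB (le_trans (ler_distD (f x) _ _))// distrC.
  rewrite [eps / C]splitr lerD// ltW// ?aM ?cM//; rewrite /D; lia.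
- by rewrite mulrC divfK// gt_eqF.
Qed.

Lemma coef_continuous f a n (eps : K) : expansion b a f -> 0 < eps ->
  exists2 A, compact A & exists2 d : K, 0 < d & forall g c, expansion b c g ->
    (forall x, A x -> `|f x - g x| < d) -> `|a n - c n| < eps.
Proof.
move=> /expansion_entireP fa eps0; have [A cA [C C0 CP]] := coef_estimate n.
have d0 : 0 < eps / C / 4 by rewrite !divr_gt0.
exists A => //; exists (eps / C / 4) => // g c /expansion_entireP gc fg.
have [M1 aM] := fa A _ cA d0; have [M2 cM] := gc A _ cA d0.
pose D := (M1 + M2 + n.+1)%N.
apply: (@le_lt_trans _ _ (C * (eps / C / 4 * 3))); last first.
  rewrite (_ : C * _ = eps * (3 / 4)); last by field; rewrite gt_eqF.
  by rewrite gtr_pMr// ltr_pdivrMr// mul1r ltr_nat.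
apply: (CP (fun n => a n - c n) D) => [|x Ax]; first by rewrite /D; lia.
rewrite partial_sumB (le_trans (ler_distD (f x) _ _))// distrC.
rewrite (_ : _ * 3 = eps / C / 4 + (eps / C / 4 + eps / C / 4)); last by ring.
have [D1 D2] : (M1 <= D)%N /\ (M2 <= D)%N by rewrite /D; split; lia.
rewrite lerD//; first by rewrite ltW// aM.
by rewrite (le_trans (ler_distD (g x) _ _))// lerD// ltW// ?fg ?cM.
Qed.

(** The n-th coefficients of approximants of f within 2 ^ -k form a Cauchy
    sequence; any approximant of f then has its n-th coefficient near the
    limit. *)
Lemma limit_coef f n : exists alpha : K, exists2 A, compact A &
  exists2 C : K, 0 < C & forall c D (eps : K), 0 < eps -> (n < D)%N ->
    (forall x, A x -> `|f x - partial_sum c D x| <= eps) ->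
      `|alpha - c n| <= C * eps.
Proof.
have [A cA [C C0 CP]] := coef_estimate n.
have h0 k : 0 < 2^-1 ^+ k :> K by rewrite exprn_gt0// invr_gt0.
have step (k : nat) : exists p : (nat -> K) * nat, [/\ (n < p.2)%N,
    forall j, (p.2 <= j)%N -> p.1 j = 0 &
    forall x, A x -> `|f x - partial_sum p.1 p.2 x| <= 2^-1 ^+ k].
  by have [a [N aN]] := b_dense_long f n.+1 cA (h0 k); exists (a, N).
have [p pP] := choice step.
have close c c' D D' (e1 e2 : K) : (n < D)%N -> (n < D')%N ->
    (forall j, (D <= j)%N -> c j = 0) -> (forall j, (D' <= j)%N -> c' j = 0) ->
    (forall x, A x -> `|f x - partial_sum c D x| <= e1) ->
    (forall x, A x -> `|f x - partial_sum c' D' x| <= e2) ->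
      `|c n - c' n| <= C * (e1 + e2).
  move=> nD nD' c0 c'0 ce ce'; apply: (CP (fun n => c n - c' n) (D + D')%N).
    by rewrite (leq_trans nD)// leq_addr.
  move=> x Ax; rewrite partial_sumB (partial_sum_tail x c0) ?leq_addr//
    (partial_sum_tail x c'0) ?leq_addl//.
  by rewrite (le_trans (ler_distD (f x) _ _))// distrC lerD ?ce ?ce'.
have [|alpha alphaP] := @interval_cauchy K Kc (fun k => (p k).1 n) (fun k =>
  C * 2^-1 ^+ k).
  move=> k l; have [k1 k2 k3] := pP k; have [l1 l2 l3] := pP l.
  by rewrite -mulrDr; apply: close k3 l3.
exists alpha, A => //; exists (2 * C) => [|c D eps eps0 nD cD];
  first by rewrite mulr_gt0.
have [k] := archimedean_exp Ka (ler0n K 3) eps0; rewrite -exprVn => /ltW k3.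
have [k1 k2 k4] := pP k.
pose c' j := if (j < D)%N then c j else 0.
have c'E x : partial_sum c' D x = partial_sum c D x by apply: eq_bigr => j _;
  rewrite /c' ltn_ord.
have cn : `|(p k).1 n - c' n| <= C * (2^-1 ^+ k + eps).
  apply: close k1 nD k2 _ k4 _ => [j|x Ax]; last by rewrite c'E cD.
  by rewrite /c' ltnNge => ->.
rewrite /c' nD in cn.
rewrite (le_trans (ler_distD ((p k).1 n) _ _))//
  (le_trans (lerD (alphaP k) cn))//.
rewrite (_ : _ + _ = C * (3 * 2^-1 ^+ k + eps)); last by ring.
by rewrite (_ : 2 * C * eps = C * (eps + eps)) ?ler_pM2l ?lerD2r//; ring.
Qed.

(** The partial sums of f are compared with those of an approximant, which are
    eventually constant; the equicontinuity of the partial sum operators, known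
    only on finite sums, is applied after replacing the first N coefficients of
    f by those of a much better approximant. *)
Lemma expansion_exists f : exists a, expansion b a f.
Proof.
have [alpha alphaP] := choice (limit_coef f).
exists alpha; apply/expansion_entireP => A eps cA eps0.
have [A' cA' [C C0 CP]] := b_grunblum cA.
pose eta := eps / (2 * C + 3).
have C3 : 0 < 2 * C + 3 by rewrite addr_gt0// mulr_gt0.
have eta0 : 0 < eta by rewrite divr_gt0.
have [a [D [_ aD aA]]] := b_dense_long f 0 (compactU cA cA') eta0.
exists D => N DN x Ax.
(* approximants that are close to alpha up to the index N *)
have [c [D' [ND' cD' cA'x cx]]] : exists c D', [/\ (N <= D')%N,
    forall n, (D' <= n)%N -> c n = 0,
    forall x, A' x -> `|f x - partial_sum c D' x| <= eta &
    `|partial_sum c N x - partial_sum alpha N x| <= eta].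
  have [U [cU [S [S0 US]]]] : exists U : set X, compact U /\ exists S : K,
    0 <= S /\
      forall c D' (d : K), 0 < d -> (N <= D')%N ->
      (forall x, U x -> `|f x - partial_sum c D' x| <= d) ->
      `|partial_sum c N x - partial_sum alpha N x| <= S * d.
    move: {DN}N => N; elim: N => [|N [U [cU [S [S0 US]]]]].
      exists set0; split; first exact: compact0.
      by exists 0; split=> // c D' d _ _ _;
        rewrite /partial_sum !big_ord0 subrr normr0 mul0r.
    have [V cV [CV CV0 CVP]] := alphaP N.
    exists (U `|` V); split; first exact: compactU.
    exists (S + CV * `|b N x|); split; first by rewrite addr_ge0// mulr_ge0//
      ltW.
    move=> c D' d d0 ND' UV;
      rewrite /partial_sum !big_ord_recr/= opprD addrACA mulrDl.
    rewrite (le_trans (ler_normD _ _))// lerD//.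
      by apply: US (ltnW ND') _ => // y Uy; apply: UV; left.
    rewrite -mulrBl normrM mulrAC ler_wpM2r// distrC.
    by apply: CVP ND' _ => // y Vy; apply: UV; right.
  have S10 : 0 < S + 1 by rewrite ltr_wpDl.
  have m0 : 0 < eta / (S + 1) by rewrite divr_gt0.
  have [d d0 [de dS]] : exists2 d : K, 0 < d & d <= eta /\ S * d <= eta.
    exists (eta / (S + 1)) => //; split; first by rewrite ler_pdivrMr//
      (ler_peMr (ltW eta0))// lerDr.
    by rewrite mulrCA (ler_piMr (ltW eta0))// ler_pdivrMr// mul1r lerDl.
  have [c [D' [ND' cD' cd]]] := b_dense_long f N (compactU cA' cU) d0.
  exists c, D'; split=> // [y A'y|]; first by rewrite (le_trans (cd _ _))//;
    left.
  by rewrite (le_trans (US c D' d d0 ND' _))// => y Uy; apply: cd; right.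
have main : `|partial_sum a N x - partial_sum c N x| <= C * (eta + eta).
  rewrite -partial_sumB; apply: (CP _ N (D + D')%N) => //;
    first by rewrite (leq_trans ND')// leq_addl.
  move=> y A'y; rewrite partial_sumB (partial_sum_tail y aD) ?leq_addr//
    (partial_sum_tail y cD') ?leq_addl//.
  rewrite (le_trans (ler_distD (f y) _ _))// distrC lerD ?cA'x// aA//.
  by right.
apply: (@le_lt_trans _ _ (eta + (C * (eta + eta) + eta))).
  rewrite (le_trans (ler_distD (partial_sum a N x) _ _))// lerD//.
    by rewrite (partial_sum_tail x aD DN) aA//; left.
  by rewrite (le_trans (ler_distD (partial_sum c N x) _ _))// lerD.
rewrite (_ : _ + _ = eps * ((2 * C + 2) / (2 * C + 3))); last first.
  by rewrite /eta; field; rewrite gt_eqF.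
by rewrite gtr_pMr// ltr_pdivrMr// mul1r ltrD2l ltr_nat.
Qed.

(** The Banach-Grunblum criterion: the coefficients come from the completeness
    of K, and density identifies the sum. *)
Theorem schauder_criterion : schauder_basis b.
Proof.
have ex1 f : exists! a, expansion b a f.
  have [a af] := expansion_exists f; exists a; split=> // c.
  exact: expansion_coef_unique.
split=> // j f U /nbhs_ballP[eps /= eps0 epsU].
have coefP g : expansion b (fun j => coef b j g) g.
  have [a [ag _]] := ex1 g.
  exact: (@xgetPex _ (fun=> 0) [set a | expansion b a g] (ex_intro _ a ag)).
have [A cA [d d0 dP]] := coef_continuous j (coefP f) eps0.
apply/nbhs_entireP; exists A, d; split=> // g fg; apply: epsU.
by rewrite -ball_normE/=; apply: dP (coefP g) fg.
Qed.

End BasisCriterion.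

(** * The square order on multi-indices *)

Section Multiindices.
Implicit Types (alpha beta : multiindex) (m j : nat).

Lemma mlen_gt alpha j : alpha j != 0%N -> (j < mlen alpha)%N.
Proof.
move=> aj; have js : j \in finsupp alpha by rewrite mem_finsupp.
exact: (leq_bigmax_seq (F := fun j => j.+1)).
Qed.

Lemma big_finsupp (T : Type) (idx : T) (op : Monoid.com_law idx) alpha m
    (F : nat -> T) :
  (mlen alpha <= m)%N -> (forall j, alpha j = 0%N -> F j = idx) ->
  \big[op/idx]_(j <- finsupp alpha) F j = \big[op/idx]_(j < m) F j.
Proof.
move=> am F0; rewrite -(big_mkord xpredT F) (bigID (fun j =>
  j \in finsupp alpha))/=.
rewrite [X in op _ X]big1 => [|j]; last by rewrite memNfinsupp => /eqP /F0.
rewrite Monoid.mulm1 -[RHS]big_filter; apply: perm_big; apply: uniq_perm.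
- exact: fset_uniq.
- by rewrite filter_uniq// iota_uniq.
move=> j; rewrite mem_filter mem_index_iota /=.
case: (boolP (j \in finsupp alpha)) => //; rewrite mem_finsupp => /mlen_gt jm.
by rewrite (leq_trans jm am).
Qed.

Lemma square_lt_colex alpha beta j : (alpha j < beta j)%N ->
  (forall i, (j < i)%N -> alpha i = beta i) -> square_lt alpha beta.
Proof.
move=> ab eqab; have ab_len : (mlen alpha <= mlen beta)%N.
  apply/bigmax_leqP_seq => i; rewrite mem_finsupp => ai _.
  have [ij|ji] := leqP i j; last by rewrite mlen_gt// -eqab.
  by rewrite (@leq_trans j.+1)// mlen_gt// -lt0n (leq_trans _ ab).
rewrite /square_lt; move: ab_len; rewrite leq_eqVlt => /predU1P[->|];
  last by left.
by right; split=> //; exists j; split=> //; move=> abj; rewrite abj ltnn in ab.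
Qed.

Lemma multiindex_of (a : nat -> nat) m : exists2 alpha : multiindex,
  (mlen alpha <= m)%N & forall j, (j < m)%N -> alpha j = a j.
Proof.
pose S : {fset nat} := seq_fset tt (iota 0 m).
pose alpha : multiindex := [fsfun j in S => a j | 0%N].
have memS j : (j \in S) = (j < m)%N by rewrite seq_fsetE mem_iota.
exists alpha => [|j jm]; last by rewrite fsfunE memS jm.
apply/bigmax_leqP_seq => j; rewrite mem_finsupp fsfunE memS => + _.
by case: ltnP.
Qed.

End Multiindices.

(** * Monomial expansions *)

Section Monomials.
Context (K : numClosedFieldType) (X : normedModType K) (e : nat -> X).
Hypotheses (Kc : interval_complete K) (Ka : archimedean_norm K)
  (cD : compact [set z : K^o | `|z| <= 1])
  (e_basis : schauder_basis e) (e_uncond : unconditional1 e).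
Context (phi : nat -> multiindex) (phi_compat : compatible_enum phi).
Implicit Types (f : entire X) (A : set X) (x : X) (z l : nat -> K).

Let b n := monomial e_basis (phi n).

Lemma monomialE (alpha : multiindex) m x : (mlen alpha <= m)%N ->
  monomial e_basis alpha x = \prod_(j < m) coef e j x ^+ alpha j.
Proof.
by move=> am; apply: (big_finsupp _ am) => j ->; rewrite expr0.
Qed.

Lemma monomial_neq0 n : exists x, b n x != 0.
Proof.
pose m := mlen (phi n); exists (fsum e m (fun=> 1)).
rewrite (monomialE _ (leqnn m)) big1 ?oner_neq0// => j _.
by rewrite coef_fsum// ltn_ord expr1n.
Qed.

(** Fix x in A. The multipliers l of modulus at most 2 move x inside the compact
    set A', and turn a sum of monomials at x into a polynomial in l. A partial
    sum in a compatible order is an initial segment of the square order in every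
    degree. *)
Lemma monomial_grunblum A : compact A -> exists2 A', compact A' &
  exists2 C : K, 0 < C & forall (a : nat -> K) N D (B : K), (N <= D)%N ->
    (forall x, A' x -> `|partial_sum b a D x| <= B) ->
    forall x, A x -> `|partial_sum b a N x| <= C * B.
Proof.
move=> cA; exists (solid_hull e 2 A); first exact: compact_solid_hull.
exists 4 => // a N D B ND aB x Ax.
pose m := (\max_(n < D) mlen (phi n))%N.
have phim n : n \in iota 0 D -> (mlen (phi n) <= m)%N.
  by rewrite mem_iota => nD; exact: (@leq_bigmax _ (fun n : 'I_D =>
    mlen (phi n)) (Ordinal nD)).
pose c n := a n * b n x.
have -> : partial_sum b a N x = \sum_(n <- iota 0 D | (n < N)%N) c n.
  rewrite /partial_sum (big_ord_widen D c)// -(big_mkord (fun n => n < N)%N c).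
  by rewrite /index_iota subn0.
apply: (@compatible_partial_sum_bound _ _ (fun n j => phi n j) m) =>
  [n j nD mj|n n' nD n'D deg|l l2].
- apply/eqP; apply: contraTT mj => /mlen_gt jl.
  by rewrite -ltnNge (leq_trans jl)// phim.
- have degE i : i \in iota 0 D -> mdeg (phi i) = (\sum_(j < m) phi i j)%N.
    by move=> iD; apply: (big_finsupp _ (phim i iD)).
  case=> [eqn|[j lt_j eq_j]].
    have -> // : n = n'; have [[psi phiK _] _] := phi_compat.
    by rewrite -(phiK n) -(phiK n'); congr psi; apply/fsfunP.
  move/(leq_trans _); apply; apply: ltnW.
  apply/(phi_compat.2 _ n n' (degE _ nD)); first by rewrite degE// deg.
  exact: square_lt_colex lt_j eq_j.
pose l' j := l j / 2.
have l'1 : bounded1 l'.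
  by move=> j; rewrite /l' normrM normfV normr_nat ler_pdivrMr// mul1r.
have -> : \sum_(n <- iota 0 D) c n * eval_monomial (fun n j => phi n j) m l n =
    partial_sum b a D (2 *: mult e l' x).
  rewrite /partial_sum -(big_mkord xpredT (fun n =>
    a n * b n (2 *: mult e l' x))).
  rewrite /index_iota subn0 big_seq [RHS]big_seq; apply: eq_bigr => n nD.
  rewrite /c /b !(monomialE _ (phim n nD)) -mulrA /eval_monomial -big_split/=.
  congr (_ * _); apply: eq_bigr => j _; rewrite coefZ// coef_mult// -exprMn.
  by congr (_ ^+ _); rewrite /l'; field.
by apply: aB; exists x, l'.
Qed.

(** The truncations are contractions converging to the identity, hence do so
    locally uniformly, and f is continuous. *)
Lemma truncate_uniform f A (eps : K) : compact A -> 0 < eps ->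
  exists m, forall x, A x -> `|f x - f (truncate e m x)| < eps.
Proof.
move=> /compact_near_coveringP cA eps0.
suff [M _ MP] : \forall m \near \oo, A `<=` (fun x =>
  `|f x - f (truncate e m x)| < eps).
  by exists M => x; exact: (MP M (leqnn M)).
apply: (cA nat \oo (fun m x => `|f x - f (truncate e m x)| < eps)) => x Ax.
have eps2 : 0 < eps / 2 by rewrite divr_gt0.
have /nbhs_ballP[d /= d0 dP] : nbhs x [set y | `|f x - f y| < eps / 2].
  apply: (differentiable_continuous (entireP f x) (t := [set z | `|f x - z| <
    eps / 2])).
  by apply/nbhs_ballP; exists (eps / 2) => //= z; rewrite -ball_normE.
have d2 : 0 < d / 2 by rewrite divr_gt0.
have [M MP] := truncate_cvg e_basis x d2.
exists (ball x (d / 2), [set m | (M <= m)%N]).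
  by split; [exact: nbhsx_ballx|exists M].
move=> [x' m] [/=]; rewrite -ball_normE/= => xx' Mm.
have xd y : `|x - y| < d -> `|f x - f y| < eps / 2.
  by move=> xy; apply: dP; rewrite -ball_normE.
rewrite (le_lt_trans (ler_distD (f x) _ _))// [eps]splitr ltrD//.
  by rewrite distrC xd// (lt_le_trans xx')// ler_piMr ?ltW// invf_lt1// ltr1n.
apply: xd; rewrite (le_lt_trans (ler_distD (truncate e m x) _ _))// [d]splitr.
rewrite ltr_leD ?MP// !truncate_mult// -multB//; last exact: truncate_indicator.
by rewrite (le_trans (mult_le _ _ _ _))// ?ltW//; exact: truncate_indicator.
Qed.

Definition polyfun m (p : (nat -> K) -> K) := exists s : seq (K * (nat -> nat)),
  forall z, p z = \sum_(i <- s) i.1 * \prod_(j < m) z j ^+ i.2 j.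

Lemma polyfun_sum m (I : Type) (r : seq I) (F : I -> (nat -> K) -> K) :
  (forall i, polyfun m (F i)) -> polyfun m (fun z => \sum_(i <- r) F i z).
Proof.
move=> pF; elim: r => [|i r [s sP]]; first by exists [::] => z;
  rewrite !big_nil.
have [t tP] := pF i; exists (t ++ s) => z.
by rewrite big_cons big_cat/= -tP -sP.
Qed.

Lemma polyfunM m (q : {poly K}) p : polyfun m p ->
  polyfun m.+1 (fun z => q.[z m] * p z).
Proof.
move=> [s sP].
pose F (k : 'I_(size q)) z := q`_k * z m ^+ k * p z.
have : polyfun m.+1 (fun z => \sum_(k <- enum 'I_(size q)) F k z).
  apply: polyfun_sum => k.
  exists [seq (q`_k * i.1, fun j =>
    if j == m then k : nat else i.2 j) | i <- s] => z.
  rewrite /F sP mulr_sumr big_map; apply: eq_bigr => i _ /=.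
  rewrite big_ord_recr/= eqxx.
  have -> : \prod_(j < m) z j ^+ (if j == m :> nat then k : nat else i.2 j) =
      \prod_(j < m) z j ^+ i.2 j by apply: eq_bigr => j _; rewrite ltn_eqF.
  by ring.
move=> [t tP]; exists t => z; rewrite -tP /F big_enum/= -mulr_suml.
by rewrite horner_coef.
Qed.

Lemma entire_shift (f : entire X) (v : X) :
  (fun x => f (x + v)) \in @entire_pred K X.
Proof.
rewrite inE => x; apply: (@differentiable_comp _ _ _ _ (fun x => x + v) f).
  by apply: differentiableD; [exact: ex_diff|exact: differentiable_cst].
exact: entireP.
Qed.

(** A polydisc lies in the solid hull of one point. *)
Lemma polydisc_bounded f m (r : K) : 0 <= r -> exists2 B : K, 0 < B &
  forall z, (forall j, (j < m)%N -> `|z j| <= r) -> `|f (fsum e m z)| <= B.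
Proof.
move=> r0; pose o := fsum e m (fun=> 1).
have c1 : compact (solid_hull e (r + 1) [set o]).
  exact: compact_solid_hull (@compact_set1 X o).
have [B B0 fB] := entire_bounded f c1; exists B => // z zr; apply: fB.
have r1 : 0 < r + 1 by rewrite ltr_wpDl.
exists o, (fun j => if (j < m)%N then z j / (r + 1) else 0); split=> //.
  move=> j; case: ltnP => [jm|_]; last by rewrite normr0.
  rewrite normrM normfV (gtr0_norm r1) ler_pdivrMr// mul1r.
  by rewrite (le_trans (zr j jm))// lerDl.
rewrite /o mult_fsum//; last first.
  move=> j; case: ltnP => [jm|_]; last by rewrite normr0.
  rewrite normrM normfV (gtr0_norm r1) ler_pdivrMr// mul1r.
  by rewrite (le_trans (zr j jm))// lerDl.
rewrite /fsum scaler_sumr; apply: eq_bigr => j _.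
by rewrite ltn_ord mulr1 scalerA mulrC divfK// gt_eqF.
Qed.

Lemma poly_bounded (q : {poly K}) (r : K) : 0 <= r -> exists2 L : K, 0 <= L &
  forall w, `|w| <= r -> `|q.[w]| <= L.
Proof.
move=> r0; exists (\sum_(k < size q) `|q`_k| * r ^+ k).
  by apply: sumr_ge0 => k _; rewrite mulr_ge0// exprn_ge0.
move=> w wr; rewrite horner_coef (le_trans (ler_norm_sum _ _ _))//.
apply: ler_sum => k _; rewrite normrM normrX ler_wpM2l//.
by rewrite lerXn2r ?nnegrE.
Qed.

(** Interpolate in the last variable. The values at the nodes are entire
    functions of the others, since the rule involves only finitely many
    translates of f, and are approximated by induction. *)
Lemma polydisc_approx m f (r eps : K) : 0 <= r -> 0 < eps ->
  exists2 p, polyfun m p & forall z, (forall j, (j < m)%N -> `|z j| <= r) ->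
    `|f (fsum e m z) - p z| <= eps.
Proof.
move=> r0; elim: m f eps => [|m ih] f eps eps0.
  exists (fun=> f 0).
    by exists [:: (f 0, fun=> 0%N)] => z; rewrite big_seq1 big_ord0 mulr1.
  by move=> z _; rewrite /fsum big_ord0 subrr normr0 ltW.
have [R R0 RP] := entire_interpolation Kc Ka r0.
have [B B0 fB] := polydisc_bounded f m.+1 (addr_ge0 r0 (ltW R0)).
have e1 : 0 < eps / 2 / B by rewrite !divr_gt0.
have [rule ruleP] := RP _ e1.
have [L L0 LP] : exists2 L : K, 0 <= L & forall w, `|w| <= r ->
    \sum_(i <- rule) `|i.2.[w]| <= L.
  elim: (rule) => [|i s [L L0 LP]]; first by exists 0 => // w _;
    rewrite big_nil.
  have [L1 L10 L1P] := poly_bounded i.2 r0.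
  by exists (L1 + L) => [|w wr]; rewrite ?addr_ge0// big_cons lerD ?L1P ?LP.
have e2 : 0 < eps / 2 / (L + 1) by rewrite !divr_gt0// ltr_wpDl.
pose fs (w : K) := Entire (entire_shift f (w *: e m)).
have step w : exists p, polyfun m p /\ forall z, (forall j, (j < m)%N ->
  `|z j| <= r) ->
    `|fs w (fsum e m z) - p z| <= eps / 2 / (L + 1).
  by have [p pm pP] := ih (fs w) _ e2; exists p.
have [P PP] := choice step.
exists (fun z => \sum_(i <- rule) i.2.[z m] * P i.1 z).
  by apply: polyfun_sum => i; apply: polyfunM; have [] := PP i.1.
move=> z zr; have zm : `|z m| <= r by apply: zr.
pose g w := f (fsum e m z + w *: e m).
have fE : f (fsum e m.+1 z) = g (z m) by rewrite /g /fsum big_ord_recr.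
have dg w : cdiff g w by apply: differentiable_line; exact: entireP.
have gB w : `|w| <= R -> `|g w| <= B.
  move=> wR; pose z' j := if j == m then w else z j.
  have -> : g w = f (fsum e m.+1 z').
    rewrite /g /fsum big_ord_recr/= /z' eqxx; congr (f (_ + _)).
    by apply: eq_bigr => j _; rewrite ltn_eqF.
  apply: fB => j jm; rewrite /z'; case: eqP => [_|_].
    by rewrite (le_trans wR)// lerDr.
  by rewrite (le_trans (zr j jm))// lerDl ltW.
have := ruleP g B dg gB (z m) zm; rewrite divfK ?gt_eqF// => le1.
rewrite fE (le_trans (ler_distD (apply_rule rule g (z m)) _ _))//
  [leRHS]splitr lerD//.
rewrite /apply_rule -sumrB (le_trans (ler_norm_sum _ _ _))//.
apply: (@le_trans _ _ (\sum_(i <- rule) `|i.2.[z m]| * (eps / 2 / (L + 1)))).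
  apply: ler_sum => i _; rewrite -mulrBr normrM ler_wpM2l//.
  have [_ Pi] := PP i.1; apply: Pi => j jm; apply: zr.
  exact: ltnW.
rewrite -mulr_suml mulrA ler_pdivrMr ?ltr_wpDl//
  mulrC ler_wpM2l ?ltW ?divr_gt0//.
by rewrite (le_lt_trans (LP _ zm))// ltrDl.
Qed.

Lemma polyfun_partial_sum m p : polyfun m p -> exists a N, forall x,
  p (fun j => coef e j x) = partial_sum b a N x.
Proof.
move=> [s]; elim: s p => [|[c al] s ih] p sP.
  by exists (fun=> 0), 0%N => x; rewrite sP big_nil /partial_sum big_ord0.
have [a [N aN]] := ih _ (fun z => erefl).
have [alpha am alphaE] := multiindex_of al m.
have [[psi _ psiK] _] := phi_compat; pose k := psi alpha.
pose a1 n := if (n < N)%N then a n else 0; pose a2 n := if n == k then c else 0.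
exists (fun n => a1 n - - a2 n), (N + k.+1)%N => x.
rewrite sP big_cons aN partial_sumB addrC; congr (_ + _).
  rewrite (@partial_sum_tail _ _ _ a1 N) ?leq_addr//.
    by apply: eq_bigr => i _; rewrite /a1 ltn_ord.
  by move=> n; rewrite /a1 ltnNge => ->.
have kN : (k < N + k.+1)%N by rewrite addnS ltnS leq_addl.
have -> : partial_sum b (fun n => - a2 n) (N + k.+1) x = - (c * b k x).
  rewrite /partial_sum (bigD1 (Ordinal kN))//= big1 ?addr0 => [|i].
    by rewrite /a2 eqxx mulNr.
  by rewrite -val_eqE /= /a2 => /negPf ->; rewrite oppr0 mul0r.
rewrite opprK /b /k psiK (monomialE _ am); congr (_ * _).
by apply: eq_bigr => j _; rewrite alphaE.
Qed.

Lemma coef_bounded A m : compact A -> exists2 r : K, 0 <= r &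
  forall x j, A x -> (j < m)%N -> `|coef e j x| <= r.
Proof.
move=> cA; elim: m => [|m [r r0 rP]]; first by exists 0.
have em : (coef e m : X -> K^o) \in @entire_pred K X.
  by rewrite inE => x; exact: coef_differentiable.
have [B B0 BP] := entire_bounded (Entire em) cA.
exists (r + B) => [|x j Ax]; first by rewrite addr_ge0// ltW.
rewrite ltnS leq_eqVlt => /predU1P[->|jm].
  by rewrite (le_trans (BP x Ax))// lerDr.
by rewrite (le_trans (rP x j Ax jm))// lerDl ltW.
Qed.

Lemma monomial_dense f A (eps : K) : compact A -> 0 < eps ->
  exists a N, forall x, A x -> `|f x - partial_sum b a N x| <= eps.
Proof.
move=> cA eps0; have eps2 : 0 < eps / 2 by rewrite divr_gt0.
have [m fm] := truncate_uniform f cA eps2.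
have [r r0 rA] := coef_bounded m cA.
have [p pp pf] := polydisc_approx m f r0 eps2.
have [a [N aN]] := polyfun_partial_sum pp.
exists a, N => x Ax; rewrite -aN (le_trans (ler_distD (f (truncate e m x)) _
  _))//.
rewrite [eps]splitr lerD ?(ltW (fm _ _))//.
by apply: pf => j; exact: rA.
Qed.

Theorem monomial_basis : schauder_basis b.
Proof.
apply: schauder_criterion => //.
- exact: monomial_neq0.
- exact: monomial_grunblum.
- exact: monomial_dense.
Qed.
End Monomials.

(** * The complex numbers *)

Section ComplexNumbers.
Context (R : realType).

Lemma complex_interval_complete : interval_complete R[i].
Proof.
move=> lo hi lohi.
have ReIm k l : complex.Re (lo k) <= complex.Re (hi l) /\ complex.Im (hi l) =
  complex.Im (lo k).
  by have := lohi k l; rewrite lecE => /andP[/eqP -> ->].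
pose E : set R := [set complex.Re (lo k) | k in [set: nat]].
have supE : has_sup E.
  split; first by exists (complex.Re (lo 0%N)), 0%N.
  by exists (complex.Re (hi 0%N)) => _ [k _ <-]; have [] := ReIm k 0%N.
exists (Complex (sup E) (complex.Im (lo 0%N))) => k; rewrite !lecE/=.
have -> : complex.Im (lo k) = complex.Im (lo 0%N).
  by have [_ <-] := ReIm k 0%N; have [_ <-] := ReIm 0%N 0%N.
have [_ ->] := ReIm 0%N k; rewrite !eqxx/=; apply/andP; split.
  by apply: sup_upper_bound => //; exists k.
by apply: sup_le_ub; [case: supE|move=> _ [j _ <-]; have [] := ReIm j k].
Qed.

Lemma complex_archimedean : archimedean_norm R[i].
Proof.
move=> x; rewrite lecE/= => /andP[/eqP xi x0];
  exists (Num.bound (complex.Re x)).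
rewrite -(rmorph_nat (real_complex R)) ltcE/= xi eqxx/=.
exact: archi_boundP.
Qed.

Lemma complex_disc_compact : compact [set z : R[i]^o | `|z| <= 1].
Proof.
pose F (p : R^o * R^o) : R[i]^o := Complex p.1 p.2.
have norm_real (a : R) : `|real_complex R a| = real_complex R `|a|.
  by rewrite normc_def/= expr0n addr0 sqrtr_sqr.
have F_le (a b : R) : `|Complex a b| <= real_complex R (`|a| + `|b|).
  rewrite [Complex a b]complexE/= (le_trans (ler_normD _ _))//.
  by rewrite normrM complexiE normCi mul1r !norm_real rmorphD.
have Fc : continuous F.
  move=> [a b] U /nbhs_ballP[eps /= eps0 epsU].
  have [d epsE] : exists d : R, eps = real_complex R d.
    by exists (complex.Re eps); rewrite RRe_real// gtr0_real.
  have d2 : 0 < d / 2 by rewrite divr_gt0// -(ltcR 0) -epsE.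
  exists (ball (a : R^o) (d / 2), ball (b : R^o) (d / 2)).
    by split; exact: nbhsx_ballx.
  move=> [a' b'] [/=]; rewrite -!ball_normE/= => aa' bb'; apply: epsU.
  rewrite -ball_normE/= /F/=.
  have -> : Complex a b - Complex a' b' = Complex (a - a') (b - b') by [].
  by rewrite (le_lt_trans (F_le _ _))// epsE ltcR [d]splitr ltrD.
have square_compact : compact (F @` (`[-1, 1] `*` `[-1, 1])).
  apply: continuous_compact; first exact: continuous_subspaceT.
  by apply: compact_setX; exact: segment_compact.
apply: subclosed_compact square_compact _.
  rewrite -[X in closed X]setCK; apply: open_closedC; rewrite openE =>
    z /= /negP.
  rewrite -real_ltNge ?normr_real ?real1// => z1.
  apply/nbhs_ballP; exists (`|z| - 1); rewrite /= ?subr_gt0// => w.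
  rewrite -ball_normE/= ltrBrDr => zw w1.
  have := ler_normD (z - w) w; rewrite subrK => zzw.
  by have := le_lt_trans (le_trans zzw (lerD (lexx _) w1)) zw; rewrite ltxx.
move=> z /= z1; exists (complex.Re z, complex.Im z); last by rewrite /F/=;
  case: (z).
have Re_le (y : R[i]) : `|y| <= 1 -> -1 <= complex.Re y <= 1.
  move=> y1; rewrite -ler_norml -(lecR _ 1).
  exact: le_trans (normc_ge_Re y) y1.
split; rewrite /= in_itv/=; first exact: Re_le.
have := Re_le (z * - 'i%C); rewrite mulrN raddfN/= ReiNIm opprK; apply.
by rewrite normrN normrM complexiE normCi mulr1.
Qed.

End ComplexNumbers.

Theorem theorem5p2 (R : realType) (X : completeNormedModType R[i])
  (e : nat -> X) (e_basis : schauder_basis e) (e_uncond : unconditional1 e)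
  (phi : nat -> multiindex) (phi_compat : compatible_enum phi) :
  schauder_basis (fun n => monomial e_basis (phi n)).
Proof.
exact: (@monomial_basis R[i] X e (@complex_interval_complete R)
  (@complex_archimedean R) (@complex_disc_compact R)).
Qed.
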